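(* Let $g_0\in G$ and let $\lambda$ be a Borel probability measure on $\mathcal X$ admissible with respect to $\varphi^{g_0}_t$. Put $\mathcal W=\mathrm{pr}((\mathbb B^n_1g_0)\cap\{y_n>0\})$. Then for every $Y\in\mathbb R$, $$\lim_{T\to\infty}\lambda\Big\{x\in\mathcal X:\sup_{|s|\le T}\log\alpha(h^{g_0}_s(x))>Y+\tfrac kn\log T\Big\}=\int_Y^\infty\eta(y)\,dy,$$ where $\eta(y)=\frac nke^{-ny/k}\psi_0(e^{-ny/k})$ and $\psi_0\in L^1(\mathbb R_{>0})$ is the probability density with $\int_X^\infty\psi_0(r)\,dr=\mu(\{\Gamma g:\widehat{\mathbb Z}^ng\cap\mathcal C(B^k_X,\mathcal W)=\emptyset\})$ for $X>0$.
   Context: Fix integers $k\ge1$, $m\ge0$, $n=k+m+1$; $G=\mathrm{SL}(n,\mathbb R)$, $\Gamma=\mathrm{SL}(n,\mathbb Z)$, $\mathcal X=\Gamma\backslash G$, $\mu$ the right-$G$-invariant probability measure. Row vectors $y=(y',y'',y_n)\in\mathbb R^k\times\mathbb R^m\times\mathbb R$, right action; $\widehat{\mathbb Z}^n$ primitive integer vectors. $U(s)=\begin{pmatrix}1_k&0&0\\0&1_m&0\\-s&0&1\end{pmatrix}$ ($s\in\mathbb R^k$, middle block absent if $m=0$), $\Phi(t)=\mathrm{diag}(e^{(m+1)t}1_k,e^{-kt}1_m,e^{-kt})$; for $g_0\in G$, $h^{g_0}_s(x)=xg_0U(s)g_0^{-1}$, $\varphi^{g_0}_t(x)=xg_0\Phi(t)g_0^{-1}$;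 $\lambda$ is admissible w.r.t. $\varphi^{g_0}_t$ if $\lim_{t\to\infty}\lambda(\varphi^{g_0}_tE)=\mu(E)$ for all Borel $E$ with $\mu(\partial E)=0$. Fix a norm $|\cdot|$ on $\mathbb R^k$ ($B^k_X$ its closed balls) and a norm $\|\cdot\|$ on $\mathbb R^n$ ($\mathbb B^n_1$ its closed unit ball); $\alpha(x)=\max_{v\in\mathbb Z^ng\setminus\{0\}}1/\|v\|$ for $x=\Gamma g$. $\mathrm{pr}(y_1,\dots,y_n)=(y_{k+1},\dots,y_n)$; $\mathcal C(\mathcal A,\mathcal W)=\{y:y'\in y_n\mathcal A,(y'',y_n)\in\mathcal W\}$. *)

(* Defs.v *)
From HB Require Import structures.
From mathcomp Require Import all_boot all_order all_algebra.
From mathcomp Require Import all_classical all_reals all_analysis.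
Import Order.TTheory GRing.Theory Num.Theory.
Import numFieldTopology.Exports numFieldNormedType.Exports.
Unset Printing Implicit Defensive.
Local Open Scope ring_scope. Local Open Scope classical_set_scope.

Section Defs.
Variable R : realType.

Definition is_norm (p : nat) (N : 'rV[R]_p -> R) : Prop :=
  (forall x, 0 <= N x) /\ (forall x, N x = 0 -> x = 0) /\
  (forall (a : R) x, N (a *: x) = `|a| * N x) /\
  (forall x y, N (x + y) <= N x + N y).

Definition intmx (p q : nat) (z : 'M[int]_(p, q)) : 'M[R]_(p, q) :=
  map_mx (fun a : int => a%:~R) z.

Definition SLset (n : nat) : set 'M[R]_(n, n) := [set g | \det g = 1].

(* Sets of G which are left-invariant under Gamma = SL(n,Z), i.e. (preimages
   of) subsets of X = Gamma\G *)
Definition Gamma_inv (n : nat) (A : set 'M[R]_(n, n)) : Prop :=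
  A `<=` SLset n /\
  forall (gam : 'M[int]_(n, n)) (g : 'M[R]_(n, n)),
    \det gam = 1 -> A g -> A (intmx n n gam *m g).

Definition rel_open (n : nat) (A : set 'M[R]_(n, n)) : Prop :=
  exists O : set 'M[R]_(n, n), open O /\ A = O `&` SLset n.

(* open subsets of X = Gamma\G (quotient topology) *)
Definition X_open (n : nat) : set (set 'M[R]_(n, n)) :=
  [set A | Gamma_inv n A /\ rel_open n A].

(* X with its Borel sigma-algebra: points are representatives g in G *)
Definition Xspace (n : nat) := g_sigma_algebraType (X_open n).

Definition rel_interior (n : nat) (E : set 'M[R]_(n, n)) : set 'M[R]_(n, n) :=
  [set x | E x /\ exists O, open O /\ O x /\ O `&` SLset n `<=` E].
Definition bdryX (n : nat) (E : set 'M[R]_(n, n)) : set 'M[R]_(n, n) :=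
  (closure E `&` SLset n) `\` rel_interior n E.

Definition rtrans (n : nat) (E : set 'M[R]_(n, n)) (g : 'M[R]_(n, n)) :=
  [set x *m g | x in E].

Definition is_probX (n : nat) (P : probability (Xspace n) R) : Prop :=
  P (SLset n) = 1%E.

Definition right_invariant (n : nat) (mu : probability (Xspace n) R) : Prop :=
  forall (E : set (Xspace n)) (g : 'M[R]_(n, n)),
    measurable E -> E `<=` SLset n -> \det g = 1 -> mu (rtrans n E g) = mu E.

Definition sn (k : nat) (s : 'rV[R]_k) (j : nat) : R :=
  oapp (fun i : 'I_k => s 0 i) 0 (insub j).

Definition Umx (k m : nat) (s : 'rV[R]_k) : 'M[R]_((k + m).+1) :=
  \matrix_(i, j) if i == ord_max then
                   (if (j < k)%N then - sn k s j else (j == ord_max)%:R)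
                 else (i == j)%:R.

Definition Phimx (k m : nat) (t : R) : 'M[R]_((k + m).+1) :=
  diag_mx (\row_(i < (k + m).+1)
             if (i < k)%N then expR (m.+1%:R * t) else expR (- (k%:R * t))).

Definition hs (k m : nat) (g0 : 'M[R]_((k + m).+1)) (s : 'rV[R]_k)
  (x : 'M[R]_((k + m).+1)) := x *m g0 *m Umx k m s *m invmx g0.
Definition phimx (k m : nat) (g0 : 'M[R]_((k + m).+1)) (t : R) :=
  g0 *m Phimx k m t *m invmx g0.

Definition alpha (n : nat) (N : 'rV[R]_n -> R) (g : 'M[R]_(n, n)) : R :=
  sup [set (N (intmx 1 n z *m g))^-1 | z in [set z : 'rV[int]_n | z != 0]].

Definition primitive (n : nat) (z : 'rV[int]_n) : bool :=
  (\big[gcdn/0%N]_(i < n) `|z ord0 i|%N) == 1%N.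

Definition yk (k m : nat) (y : 'rV[R]_((k + m).+1)) : 'rV[R]_k :=
  \row_(i < k) y 0 (insubd ord0 i).
Definition pr (k m : nat) (y : 'rV[R]_((k + m).+1)) : 'rV[R]_m.+1 :=
  \row_(j < m.+1) y 0 (insubd ord0 (k + j)%N).
Definition ylast (k m : nat) (y : 'rV[R]_((k + m).+1)) : R := y 0 ord_max.

Definition cone (k m : nat) (A : set 'rV[R]_k) (W : set 'rV[R]_m.+1) :
  set 'rV[R]_((k + m).+1) :=
  [set y | (exists2 a, A a & yk k m y = ylast k m y *: a) /\ W (pr k m y)].

Definition Wset (k m : nat) (N : 'rV[R]_((k + m).+1) -> R)
  (g0 : 'M[R]_((k + m).+1)) : set 'rV[R]_m.+1 :=
  pr k m @` [set y | (exists2 b, N b <= 1 & y = b *m g0) /\ 0 < ylast k m y].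

End Defs.

(* Main.v *)
(** The event says that some nonzero vector [w] of the lattice [Z^n x g0] satisfies [|w U(s) g0^-1| < r] for some [|s| <= T], with [r = e^-Y T^(-k/n)].  Applying [Phi(-t)], where [e^(kt) r = 1] and [e^(nt) X = T] with [X = e^(-nY/k)], turns it into hitting a set of vectors which, as [T] grows, is squeezed between an open cone (eroded by [e]) and a compact double cone (thickened by [e]).

    Erosions and thickenings form one-parameter families whose hitting sets have disjoint boundaries, so arbitrarily small [e] give a [mu]-null boundary and admissibility applies.  Both cones have hitting measure [1 - int_X^oo psi0]: they differ from the cone of the statement by a hyperplane slice, null by invariance under shears, and by what [Phi]-invariance together with continuity of the tail of [psi0] controls. *)
Require Import Defs.
From HB Require Import structures.
From mathcomp Require Import all_boot all_order all_algebra.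
From mathcomp Require Import all_classical all_reals all_analysis.
From mathcomp Require Import measurable_realfun zify ring lra.
Import Order.TTheory GRing.Theory Num.Theory.
Import numFieldTopology.Exports numFieldNormedType.Exports.
Set Implicit Arguments.
Unset Strict Implicit.
Local Open Scope ring_scope. Local Open Scope classical_set_scope.

(** * Exponential substitution in Lebesgue integrals *)

(** With [v = w Phi(-t)] and [y = e^(kt) w U(s)], the condition on [w] says that [y] lies in the
    open unit ball times [g0], that [pr y = pr v], and that [v' = e^(-nt) (y' + v_n s)]. Since [y']
    stays bounded, its contribution dies out, while [e^(-nt) s] fills the ball [B_X]. This is the
    origin of both normalisations, and the reason why only the projection of the ball survives in
    the limit. The vanishing term [e^(-nt) y'] is also why the event is compared with translates of
    fixed hitting sets only up to an error.

    A hitting set involves infinitely many integer vectors, and the space of lattices is not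
    compact. What controls its boundary is that, locally uniformly in the lattice, only finitely
    many lattice vectors fall into a bounded region. Hence sets of vectors are kept bounded wherever
    closedness or boundaries of hitting sets matter. *)

Section ExpSubstitution.
Variables (R : realType) (a : {posnum R}) (Y : R).
Local Notation leb := (@lebesgue_measure R).
Let a0 : 0 < a%:num. Proof. by []. Qed.

Definition exp_density (y : R) : R := a%:num * expR (- (a%:num * y)).

(** The substitution [r = expR (- a y)] is proved as an equality of measures: the image of this one
    under that map is Lebesgue measure on an interval. The integrand then only has to be measurable,
    which suits a density [psi0] that is merely integrable. *)
Definition exp_measure (A : set (measurableTypeR R)) : \bar R :=
  (\int[leb]_(y in A `&` `[Y, +oo[%classic) (exp_density y)%:E)%E.

Lemma exp_density_ge0 y : 0 <= exp_density y.
Proof. by rewrite mulr_ge0// expR_ge0. Qed.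

Lemma continuous_exp_density : continuous exp_density.
Proof.
move=> y; apply: (cvgM (cvg_cst _)).
apply: (@continuous_comp _ _ _ (fun y => - (a%:num * y)) expR); last exact: continuous_expR.
by apply: cvgN; exact: (cvgM (cvg_cst _) cvg_id).
Qed.

Lemma measurable_exp_density (D : set R) :
  measurable D -> measurable_fun D (EFin \o exp_density).
Proof.
move=> mD; apply/measurable_EFinP; apply: measurable_funTS.
exact: continuous_measurable_fun continuous_exp_density.
Qed.

Let exp_measure0 : exp_measure set0 = 0%E.
Proof. by rewrite /exp_measure set0I integral_set0. Qed.

Let exp_measure_ge0 A : (0 <= exp_measure A)%E.
Proof. by apply: integral_ge0 => y _; rewrite lee_fin exp_density_ge0. Qed.

Let exp_measure_sigma_additive : semi_sigma_additive exp_measure.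
Proof.
move=> F mF tF mUF; rewrite /exp_measure; apply: cvg_toP.
  apply: ereal_nondecreasing_is_cvgn => i j ij.
  by apply: lee_sum_nneg_natr => // l _ _; exact: exp_measure_ge0.
rewrite setI_bigcupl ge0_integral_bigcup//=.
- by move=> i; apply: measurableI => //; exact: measurable_itv.
- apply: measurable_exp_density; rewrite -setI_bigcupl; apply: measurableI => //.
- by move=> y _; rewrite lee_fin exp_density_ge0.
- exact: trivIset_setIr.
Qed.

HB.instance Definition _ := isMeasure.Build _ _ _
  exp_measure exp_measure0 exp_measure_ge0 exp_measure_sigma_additive.

Lemma integral_exp_density_ray (c : R) :
  (\int[leb]_(y in `[c, +oo[%classic) (exp_density y)%:E)%E = (expR (- (a%:num * c)))%:E.
Proof.
have cF : continuous (fun y : R => - expR (- (a%:num * y))).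
  move=> y; apply: cvgN.
  apply: (@continuous_comp _ _ _ (fun y => - (a%:num * y)) expR); last exact: continuous_expR.
  by apply: cvgN; exact: (cvgM (cvg_cst _) cvg_id).
have dF (y : R) : is_derive y 1 (fun y : R => - expR (- (a%:num * y))) (exp_density y).
  have -> : exp_density y = - ((expR (- (a%:num * y))) * (- a%:num)).
    by rewrite /exp_density mulrN opprK mulrC.
  apply: is_deriveN; apply: (@is_derive1_comp _ expR (fun y => - (a%:num * y))).
  apply: is_deriveN; apply: is_derive_eq.
  by rewrite /= -[RHS]mulr1.
rewrite (@ge0_continuous_FTC2y _ _ (fun y : R => - expR (- (a%:num * y))) _ 0).
- by rewrite sub0e EFinN oppeK.
- by move=> y _; exact: exp_density_ge0.
- by apply: continuous_subspaceT; exact: continuous_exp_density.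
- rewrite -[X in _ --> X]oppr0; apply: cvgN.
  apply: (@cvg_comp _ _ _ (fun y => a%:num * y) (fun z => expR (- z)) _ (pinfty_nbhs R)).
    exact: gt0_cvgMry.
  exact: cvgr_expR.
- by move=> y _; have [] := dF y.
- by apply: cvg_at_right_filter; exact: cF.
- by move=> y _; rewrite derive1E; have [] := dF y.
Qed.

Let exp_measure_fin : fin_num_fun exp_measure.
Proof.
move=> A mA; rewrite ge0_fin_numE; last exact: exp_measure_ge0.
apply: le_lt_trans (ltry (expR (- (a%:num * Y)))).
rewrite -integral_exp_density_ray; apply: ge0_subset_integral => //.
- by apply: measurableI => //; exact: measurable_itv.
- by apply: measurable_exp_density; exact: measurable_itv.
- by move=> y _; rewrite lee_fin exp_density_ge0.
Qed.

HB.instance Definition _ := @Measure_isFinite.Build _ _ _ exp_measure exp_measure_fin.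

Let nu : {finite_measure set (measurableTypeR R) -> \bar R} := exp_measure.

Lemma exp_measureE (A : set R) : A `<=` `[Y, +oo[ ->
  exp_measure A = (\int[leb]_(y in A) (exp_density y)%:E)%E.
Proof. by move=> AY; rewrite /exp_measure (setIidl AY). Qed.

Lemma exp_measure_dominated : nu `<< leb.
Proof.
apply/null_content_dominatesP => A mA A0; rewrite /nu /= /exp_measure.
apply: null_set_integral.
- by apply: measurableI => //; exact: measurable_itv.
- by apply: measurable_exp_density; apply: measurableI => //; exact: measurable_itv.
- by apply: subset_measure0 A0 => //; apply: measurableI => //; exact: measurable_itv.
Qed.

(** The Radon-Nikodym derivative of [nu] agrees almost everywhere on the ray with [exp_density],
    since both have the same integral over every measurable subset of the ray. *)
Lemma integral_exp_measure (f : measurableTypeR R -> \bar R) : (forall y, 0 <= f y)%E ->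
  measurable_fun `[Y, +oo[%classic f ->
  (\int[nu]_(y in `[Y, +oo[%classic) f y =
   \int[leb]_(y in `[Y, +oo[%classic) (f y * (exp_density y)%:E))%E.
Proof.
move=> f0 mf; have mY := measurable_itv `[Y, +oo[%R.
have RNint := Radon_Nikodym_SigmaFinite.f_integrable exp_measure_dominated.
rewrite -(Radon_Nikodym_SigmaFinite.change_of_variables exp_measure_dominated f0 mY mf).
apply: ae_eq_integral => //.
- apply: emeasurable_funM => //; apply: measurable_funTS.
  exact: measurable_int RNint.
- by apply: emeasurable_funM => //; exact: measurable_exp_density.
apply: ae_eqe_mul2l; apply: integral_ae_eq => //.
- exact: integrableS measurableT _ _ RNint.
- exact: measurable_exp_density.
move=> E EY mE; rewrite -(Radon_Nikodym_SigmaFinite.f_integral exp_measure_dominated mE).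
exact: exp_measureE.
Qed.

Let phi (y : R) : R := expR (- (a%:num * y)).

Let phiK (r : R) : 0 < r -> phi (- (ln r / a%:num)) = r.
Proof.
move=> r0; rewrite /phi mulrN opprK mulrCA divff ?mulr1 ?lnK//.
Qed.

Let phi_lt y z : (phi y < phi z) = (z < y).
Proof. by rewrite /phi ltr_expR ltrN2 ltr_pM2l. Qed.

Let mphi : measurable_fun setT (phi : measurableTypeR R -> measurableTypeR R).
Proof.
apply: continuous_measurable_fun => y.
apply: (@continuous_comp _ _ _ (fun y => - (a%:num * y)) expR); last exact: continuous_expR.
by apply: cvgN; exact: (cvgM (cvg_cst _) cvg_id).
Qed.

(** Two measures that agree on the rays []-oo, x[] are equal: these rays are stable under
    intersection, generate the Borel sets and exhaust the line with finite measure. The three cases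
    place [x] to the left of, inside, or to the right of []0, phi Y]]. *)
Lemma pushforward_exp_measure (A : set (measurableTypeR R)) : measurable A ->
  pushforward exp_measure (phi : measurableTypeR R -> measurableTypeR R) A =
  leb (A `&` `]0, phi Y]).
Proof.
move=> mA.
pose m1 := (pushforward exp_measure (phi : measurableTypeR R -> measurableTypeR R)
  : {measure set (measurableTypeR R) -> \bar R}).
pose m2 : {measure set (measurableTypeR R) -> \bar R} :=
  mrestr leb (measurable_itv `]0, phi Y]%R).
suff : m1 mphi A = m2 A by [].
apply: (@measure_unique _ R (measurableTypeR R) (@RGenInftyO.G R)
  (fun i => `]-oo, i%:R[%classic)) => //.
- exact: RGenInftyO.measurableE.
- move=> _ _ [x ->] [y ->]; exists (Num.min x y); apply/seteqP; split=> r /=.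
    by rewrite !in_itv/= lt_min => -[-> ->].
  by rewrite !in_itv/= lt_min => /andP[-> ->].
- by move=> i; exists i%:R.
- rewrite -subTset => r _; exists (Num.truncn r).+1 => //=; rewrite in_itv/=.
  exact: truncnS_gt.
- move=> _ [x ->].
  change (exp_measure (phi @^-1` `]-oo, x[) = leb (`]-oo, x[ `&` `]0, phi Y])).
  have phiY0 : 0 < phi Y by exact: expR_gt0.
  have [x0|x0] := leP x 0.
    rewrite (_ : _ @^-1` _ = set0); last first.
      rewrite -subset0 => y /=; rewrite in_itv/= => yx.
      by have := expR_gt0 (- (a%:num * y)); rewrite -/(phi y); lra.
    rewrite (_ : _ `&` _ = set0) ?measure0//.
    by rewrite -subset0 => r /= []; rewrite !in_itv/=; lra.
  have [xX|Xx] := leP x (phi Y).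
    pose c := - (ln x / a%:num).
    have cE : phi c = x by exact: phiK.
    have Yc : Y <= c by rewrite leNgt -phi_lt cE -leNgt.
    have -> : phi @^-1` `]-oo, x[ = `]c, +oo[%classic.
      by apply/seteqP; split=> y /=; rewrite !in_itv/= andbT -{1}cE phi_lt.
    rewrite exp_measureE; last first.
      by move=> y /=; rewrite !in_itv/= !andbT => /ltW; exact: le_trans.
    rewrite integral_itv_obnd_cbnd; last first.
      by apply: measurable_exp_density; exact: measurable_itv.
    rewrite integral_exp_density_ray -/(phi c) cE.
    rewrite (_ : _ `&` _ = `]0, x[%classic).
      by rewrite lebesgue_measure_itv/= lte_fin x0 sube0.
    apply/seteqP; split=> r /=; rewrite !in_itv/=; first by move=> [-> /andP[->]].
    by move=> /andP[-> rx]; split=> //=; rewrite (le_trans (ltW rx)).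
  rewrite (_ : _ `&` _ = `]0, phi Y]%classic); last first.
    apply/setIidPr => r /=; rewrite !in_itv/= => /andP[_ rY].
    exact: le_lt_trans rY Xx.
  rewrite lebesgue_measure_itv/= lte_fin phiY0 sube0.
  rewrite -integral_exp_density_ray /exp_measure; congr (integral _ _ _).
  apply/setIidPr => y /=; rewrite !in_itv/= andbT => Yy.
  by apply: le_lt_trans Xx; rewrite leNgt phi_lt -leNgt.
- move=> i; rewrite -ge0_fin_numE//; apply: exp_measure_fin.
  by rewrite -[X in measurable X]setTI; apply: mphi => //; exact: measurable_itv.
Qed.

Lemma integral_exp_substitution (f : measurableTypeR R -> R) : (forall r, 0 < r -> 0 <= f r) ->
  measurable_fun `]0%R, expR (- (a%:num * Y))]%classic (EFin \o f) ->
  (\int[leb]_(y in `[Y, +oo[%classic) (exp_density y * f (expR (- (a%:num * y))))%:E =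
   \int[leb]_(r in `]0%R, expR (- (a%:num * Y))]%classic) (f r)%:E)%E.
Proof.
move=> f0 mf.
have preE : phi @^-1` `]0, phi Y] = `[Y, +oo[%classic.
  have phi_le y : (phi y <= phi Y) = (Y <= y) by rewrite leNgt phi_lt -leNgt.
  by apply/seteqP; split=> y /=; rewrite !in_itv/= andbT phi_le expR_gt0.
have mD := measurable_itv `]0, phi Y]%R.
transitivity (\int[pushforward exp_measure (phi : measurableTypeR R -> measurableTypeR R)]_(r in `]0%R, phi Y]%classic) (f r)%:E)%E; last first.
  apply: eq_measure_integral => A mA AD.
  by apply: etrans (pushforward_exp_measure mA) _; rewrite (setIidl AD).
rewrite ge0_integral_pushforward//=; last first.
  by move=> r; rewrite inE/= in_itv/= => /andP[r0 _]; rewrite lee_fin; exact: f0.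
rewrite preE integral_exp_measure//=.
- by apply: eq_integral => y _; rewrite -EFinM mulrC.
- by move=> y; rewrite lee_fin f0// expR_gt0.
- apply: (measurable_comp mD _ mf); first by rewrite -preE => _ [y Dy <-].
  exact: measurable_funTS.
Qed.


End ExpSubstitution.

(** * Matrix norms and local finiteness of lattices *)

Section MatrixNorm.
Variable R : realType.

Lemma mx_entry_le_norm (p q : nat) (A : 'M[R]_(p, q)) i j : `|A i j| <= `|A|.
Proof.
rewrite [leRHS]/Num.norm /= mx_normrE; apply/bigmax_geP; right => /=.
by exists (i, j).
Qed.

Lemma mx_norm_le_entry (p q : nat) (A : 'M[R]_(p, q)) (c : R) :
  0 <= c -> (forall i j, `|A i j| <= c) -> `|A| <= c.
Proof.
move=> c0 Ac; rewrite [leLHS]/Num.norm /= mx_normrE.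
by apply/bigmax_leP; split => // -[i j] _; exact: Ac.
Qed.

Lemma mulmx_norm_le (p q r : nat) (A : 'M[R]_(p, q)) (B : 'M[R]_(q, r)) :
  `|A *m B| <= q%:R * `|A| * `|B|.
Proof.
apply: mx_norm_le_entry => [|i j]; first by rewrite !mulr_ge0.
rewrite mxE (le_trans (ler_norm_sum _ _ _))//.
rewrite (@le_trans _ _ (\sum_(k < q) `|A| * `|B|))//; last first.
  by rewrite sumr_const card_ord -mulrA mulr_natl.
by apply: ler_sum => k _; rewrite normrM ler_pM// mx_entry_le_norm.
Qed.

Lemma mx_nbhsP (p q : nat) (x : 'M[R]_(p, q)) (A : set 'M[R]_(p, q)) :
  nbhs x A <-> exists2 e : R, 0 < e & forall y, `|x - y| < e -> A y.
Proof.
split=> [/nbhs_ballP[e e0 eA]|[e e0 eA]].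
  by exists e => // y xy; apply: eA; rewrite mx_norm_ball.
by apply/nbhs_ballP; exists e => // y; rewrite mx_norm_ball; exact: eA.
Qed.

Lemma lipschitz_continuous_mx (p q p' q' : nat)
    (f : 'M[R]_(p, q) -> 'M[R]_(p', q')) (c : R) :
  (forall x y, `|f x - f y| <= c * `|x - y|) -> continuous f.
Proof.
move=> fc x A /mx_nbhsP[e e0 eA]; apply/mx_nbhsP.
have c0 : 0 < `|c| + 1 by rewrite ltr_wpDl.
exists (e / (`|c| + 1)); first by rewrite divr_gt0.
move=> y; rewrite ltr_pdivlMr// => xy; apply: eA.
apply: le_lt_trans (fc x y) _; apply: le_lt_trans xy.
rewrite mulrC ler_wpM2l//; have := ler_norm c; lra.
Qed.

Lemma mulmx2_continuous (p q r s : nat) (A : 'M[R]_(p, q)) (B : 'M[R]_(r, s)) :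
  continuous (fun x : 'M[R]_(q, r) => A *m x *m B).
Proof.
apply: (@lipschitz_continuous_mx _ _ _ _ _ (r%:R * (q%:R * `|A|) * `|B|)) => x y.
rewrite -mulmxBl -mulmxBr (le_trans (mulmx_norm_le _ _))//.
rewrite [leRHS](_ : _ = r%:R * (q%:R * `|A| * `|x - y|) * `|B|); last by ring.
by rewrite ler_wpM2r// ler_wpM2l// mulmx_norm_le.
Qed.

End MatrixNorm.

Lemma near_all_seq (T : Type) (F : set_system T) (FF : Filter F) (I : eqType)
    (s : seq I) (P : I -> T -> Prop) :
  (forall i, i \in s -> \forall y \near F, P i y) ->
  \forall y \near F, forall i, i \in s -> P i y.
Proof.
elim: s => [_|i s ih sP]; first by apply: nearW => y i; rewrite in_nil.
have := sP i (mem_head _ _); move/filterS2; apply; last first.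
  by apply: ih => j js; apply: sP; rewrite inE js orbT.
by move=> y Piy Psy j; rewrite inE => /predU1P[->|/Psy].
Qed.

Section LatticeFiniteness.
Variable R : realType.

Lemma intmx_mul (p q r : nat) (A : 'M[int]_(p, q)) (B : 'M[int]_(q, r)) :
  intmx R p r (A *m B) = intmx R p q A *m intmx R q r B.
Proof. exact: map_mxM. Qed.

Lemma intmx_ge1 (n : nat) (z : 'rV[int]_n) : z != 0 -> 1 <= `|intmx R 1 n z|.
Proof.
move=> z0; have [j zj] : exists j, z 0 j != 0.
  apply/existsP; rewrite -negb_forall; apply: contra z0 => /forallP z0.
  by apply/eqP/rowP => j; rewrite mxE; apply/eqP.
apply: le_trans (mx_entry_le_norm _ 0 j); rewrite mxE -intr_norm.
rewrite -[1]/(1%:~R) ler_int; lia.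
Qed.

Lemma bounded_integer_vectors (n : nat) (b : R) :
  exists Z : seq 'rV[int]_n, forall z, `|intmx R 1 n z| <= b -> z \in Z.
Proof.
pose N := `|Num.ceil b|%N.
(* Entries between [-N] and [N] are encoded by ordinals below [2N + 1] through a shift by [N]. *)
pose f (u : {ffun 'I_n -> 'I_(N.*2.+1)}) : 'rV[int]_n :=
  \row_j ((u j)%:Z - N%:Z).
exists [seq f u | u <- enum {: {ffun 'I_n -> 'I_(N.*2.+1)}}] => z zb.
have zN j : `|z 0 j| <= N%:Z.
  have : `|intmx R 1 n z 0 j| <= b by apply: le_trans zb; exact: mx_entry_le_norm.
  rewrite mxE -intr_norm => zjb.
  have : `|z 0 j| <= Num.ceil b by rewrite -(ler_int R) (le_trans zjb)// ceil_ge.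
  rewrite /N; lia.
apply/mapP; exists [ffun j => inord `|(z 0%R j + N%:Z)%R|%N]; first by rewrite mem_enum.
have shiftK (a : int) : `|a| <= N%:Z -> a = (absz (a + N%:Z))%:Z - N%:Z by lia.
apply/rowP => j; rewrite mxE ffunE inordK; first exact: shiftK (zN j).
by have := zN j; lia.
Qed.

(** With [M = x h], inverting [M] gives [|v| <= a |v M|], and replacing [x] by [y] costs at most
    [b |v| |x - y|]. For [|x - y| < 1 / (2ab)] this cost is absorbed into the left-hand side,
    leaving [|v| <= 2ac], a bound which is the same for all nearby lattices. *)
Lemma near_lattice_finite (n : nat) (x h : 'M[R]_n) (c : R) :
  \det x = 1 -> \det h = 1 ->
  exists Z : seq 'rV[int]_n, \forall y \near x,
    forall z, `|intmx R 1 n z *m y *m h| <= c -> z \in Z.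
Proof.
move=> x1 h1; set M := x *m h.
have Mu : M \in unitmx by rewrite unitmxE det_mulmx x1 h1 mulr1 unitr1.
pose a := n%:R * `|invmx M| + 1.
have a0 : 0 < a by rewrite ltr_wpDl// mulr_ge0.
have [Z ZP] := bounded_integer_vectors n (2 * a * c).
exists Z; pose b := n%:R * (n%:R * `|h|) + 1.
have b0 : 0 < b by rewrite ltr_wpDl// !mulr_ge0.
apply/mx_nbhsP; exists (2 * a * b)^-1; first by rewrite invr_gt0 !mulr_gt0.
move=> y; rewrite -div1r ltr_pdivlMr ?mulr_gt0// => xy z zc; apply: ZP.
set v := intmx R 1 n z in zc *.
have v_le : `|v| <= a * `|v *m M|.
  rewrite -{1}(mulmxK Mu v) (le_trans (mulmx_norm_le _ _))//.
  rewrite mulrAC ler_wpM2r// /a; lra.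
have vM_le : `|v *m M| <= c + b * `|v| * `|x - y|.
  rewrite (_ : v *m M = v *m y *m h + v *m (x - y) *m h); last first.
    by rewrite /M mulmxBr mulmxBl mulmxA addrC subrK.
  rewrite (le_trans (ler_normD _ _))// lerD//.
  rewrite (le_trans (mulmx_norm_le _ _))//.
  rewrite (@le_trans _ _ (n%:R * (n%:R * `|v| * `|x - y|) * `|h|))//.
    by rewrite ler_wpM2r// ler_wpM2l// mulmx_norm_le.
  rewrite [leLHS](_ : _ = (n%:R * (n%:R * `|h|)) * (`|v| * `|x - y|)); last ring.
  rewrite -[leRHS]mulrA ler_wpM2r ?mulr_ge0// /b; lra.
have v0 : 0 <= `|v| := normr_ge0 v.
have xyh : `|v| * (`|x - y| * (2 * a * b)) <= `|v| * 1 by rewrite ler_wpM2l// ltW.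
have : a * `|v *m M| <= a * (c + b * `|v| * `|x - y|) by rewrite ler_pM2l.
nra.
Qed.

End LatticeFiniteness.

(** * Sets of lattices hitting a given set of vectors *)

Section Hit.
Variables (R : realType) (n : nat).
Implicit Types (h x g : 'M[R]_n) (D : set 'rV[R]_n).

(** Keeping [h] apart from [x] lets right translations act on [h] alone, with [D] fixed. Vectors are
    nonzero rather than primitive; for the star-shaped cones used later the two choices give the
    same set. *)
Definition Hit h D : set 'M[R]_n :=
  [set x | \det x = 1 /\
    exists2 z : 'rV[int]_n, z != 0 & D (intmx R 1 n z *m x *m h)].

Lemma Hit_subSL h D : Hit h D `<=` SLset R n.
Proof. by move=> x []. Qed.

Lemma HitS h D D' : D `<=` D' -> Hit h D `<=` Hit h D'.
Proof. by move=> DD' x [x1 [z z0 /DD'] ?]; split=> //; exists z. Qed.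

Lemma Hit_bigcup h (D : nat -> set 'rV[R]_n) :
  Hit h (\bigcup_i D i) = \bigcup_i Hit h (D i).
Proof.
apply/seteqP; split=> x.
  by move=> [x1 [z z0 [i _ Diz]]]; exists i => //; split=> //; exists z.
by move=> [i _ [x1 [z z0 Diz]]]; split=> //; exists z => //; exists i.
Qed.

Lemma HitU h D D' : Hit h (D `|` D') = Hit h D `|` Hit h D'.
Proof.
apply/seteqP; split=> x.
  by move=> [x1 [z z0 [Dz|Dz]]]; [left|right]; split=> //; exists z.
by move=> [|] [x1 [z z0 Dz]]; split=> //; exists z => //; [left|right].
Qed.

Lemma det_intmx_mul (gam : 'M[int]_n) g :
  \det gam = 1 -> \det (intmx R n n gam *m g) = \det g.
Proof. by move=> gam1; rewrite det_mulmx det_map_mx gam1 rmorph1 mul1r. Qed.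

(** For determinant 1 the adjugate is the inverse with integer entries, so it belongs to Gamma. It
    serves to show that complements and closures of Gamma-invariant sets are invariant. *)
Lemma det_adj1 (gam : 'M[int]_n) : \det gam = 1 -> \det (\adj gam) = 1.
Proof.
move=> gam1; have := congr1 determinant (mul_adj_mx gam).
by rewrite det_mulmx gam1 mulr1 => ->; rewrite det1.
Qed.

Lemma intmx_adjK (gam : 'M[int]_n) g : \det gam = 1 ->
  intmx R n n (\adj gam) *m (intmx R n n gam *m g) = g.
Proof.
by move=> gam1; rewrite mulmxA -intmx_mul mul_adj_mx gam1 /intmx map_mx1 mul1mx.
Qed.

Lemma Hit_Gamma_inv h D : Gamma_inv R n (Hit h D).
Proof.
split; first exact: Hit_subSL.
move=> gam g gam1 [g1 [z z0 Dz]]; split; first by rewrite det_intmx_mul.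
have zE : (z *m \adj gam) *m gam = z by rewrite -mulmxA mul_adj_mx gam1 mulmx1.
exists (z *m \adj gam); first by apply: contra_neq z0 => z0; rewrite -zE z0 mul0mx.
by rewrite mulmxA -intmx_mul zE.
Qed.

Lemma SL_X_open : X_open R n (SLset R n).
Proof.
split; last by exists setT; split; [exact: openT|rewrite setTI].
by split=> // gam g gam1 /= g1; rewrite /SLset/= det_intmx_mul.
Qed.

Lemma X_open_measurable (A : set 'M[R]_n) :
  X_open R n A -> measurable (A : set (Xspace R n)).
Proof. exact: sub_sigma_algebra. Qed.

Lemma Hit_rel_open h D : open D -> exists2 V, open V & Hit h D = V `&` SLset R n.
Proof.
move=> oD; exists (\bigcup_(z in [set z : 'rV[int]_n | z != 0])
  (fun x => intmx R 1 n z *m x *m h) @^-1` D).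
  apply: bigcup_open => z _; apply: open_comp => // y _.
  exact: mulmx2_continuous.
apply/seteqP; split=> [x [x1 [z z0 Dz]]|x [[z /= z0 Dz] x1]].
  by split=> //; exists z.
by split=> //; exists z.
Qed.

Lemma measurable_Hit_open h D :
  open D -> measurable (Hit h D : set (Xspace R n)).
Proof.
move=> oD; apply: X_open_measurable; split; first exact: Hit_Gamma_inv.
by have [V oV ->] := Hit_rel_open h oD; exists V.
Qed.

(** Near [x] only finitely many integer vectors can produce a vector of norm at most [c], and each
    of these stays out of the closed set [closure D] on a neighbourhood of [x]. *)
Lemma near_notHit h D (c : R) x : \det h = 1 -> \det x = 1 ->
  (forall v, D v -> `|v| <= c) ->
  (forall z : 'rV[int]_n, z != 0 -> ~ closure D (intmx R 1 n z *m x *m h)) ->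
  \forall y \near x, ~ Hit h D y.
Proof.
move=> h1 x1 Dc xD; have [Z nearZ] := near_lattice_finite c x1 h1.
have nearD : \forall y \near x, forall z, z \in Z -> z != 0 ->
    ~ D (intmx R 1 n z *m y *m h).
  apply: (@near_all_seq _ (nbhs x) (nbhs_filter x) _ Z
    (fun z y => z != 0 -> ~ D (intmx R 1 n z *m y *m h))) => z _ /=.
  have [->|z0] := eqVneq z 0; first by apply: nearW => y /=.
  have ocD : open (~` closure D) by rewrite openC; exact: closed_closure.
  have zD := @mulmx2_continuous _ _ _ _ _ (intmx R 1 n z) h x _
    (open_nbhs_nbhs (conj ocD (xD z z0))).
  apply: (@filterS _ (nbhs x) _ _ _ _ zD) => y /= cDy _ Dy.
  by apply: cDy; exact: subset_closure.
apply: filterS2 nearZ nearD => y Zy Dy [_ [z z0 Dz]].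
exact: Dy (Zy _ (Dc _ Dz)) z0 Dz.
Qed.

(** Boundedness makes the hitting set of a closed set relatively closed: by [near_notHit] its
    complement in SL is relatively open, and this complement is again Gamma-invariant. *)
Lemma measurable_Hit_closed h D (c : R) : \det h = 1 -> closed D ->
  (forall v, D v -> `|v| <= c) -> measurable (Hit h D : set (Xspace R n)).
Proof.
move=> h1 cD Dc.
have HE : Hit h D = SLset R n `\` (SLset R n `\` Hit h D).
  by rewrite setDD; apply/esym/setIidr; exact: Hit_subSL.
rewrite HE.
apply: measurableD; apply: X_open_measurable; first exact: SL_X_open.
split; first split=> [x []//|gam g gam1 [g1 Hg]].
  split=> [|Hgg]; first by rewrite /SLset/= det_intmx_mul.
  apply: Hg; have [_ HG] := Hit_Gamma_inv h D.
  by rewrite -(intmx_adjK g gam1); exact: HG (det_adj1 gam1) Hgg.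
exists (~` Hit h D)°; split; first exact: open_interior.
apply/seteqP; split=> x.
  move=> [x1 Hx]; split=> //; apply: (near_notHit h1 x1 Dc) => z z0.
  by move/closure_id : cD => <- Dz; apply: Hx; split=> //; exists z.
by move=> [/interior_subset Hx x1]; split.
Qed.

End Hit.

(** * Invariance of the measure of hitting sets, and their boundaries *)

Section HitMeasure.
Variables (R : realType) (n : nat).
Implicit Types (h x g : 'M[R]_n) (D : set 'rV[R]_n).

Lemma rtrans_Hit h g D : \det g = 1 ->
  rtrans R n (Hit h D) g = Hit (invmx g *m h) D.
Proof.
move=> g1; have gu : g \in unitmx by rewrite unitmxE g1 unitr1.
apply/seteqP; split=> [_ [x [x1 [z z0 Dz]] <-]|y [y1 [z z0 Dz]]].
  split; first by rewrite det_mulmx x1 g1 mulr1.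
  by exists z => //; rewrite !mulmxA mulmxK.
exists (y *m invmx g); last by rewrite mulmxKV.
split; first by rewrite det_mulmx y1 det_inv g1 invr1 mulr1.
by exists z => //; move: Dz; rewrite !mulmxA.
Qed.

Variable mu : probability (Xspace R n) R.

(** Passing from [h] to [h'] is the right translation by [h h'^-1], so the measure depends on [D]
    only. *)
Lemma Hit_invariant h h' D : right_invariant R n mu ->
  \det h = 1 -> \det h' = 1 -> measurable (Hit h D : set (Xspace R n)) ->
  mu (Hit h' D) = mu (Hit h D).
Proof.
move=> mu_inv h1 h'1 mH.
have h'u : h' \in unitmx by rewrite unitmxE h'1 unitr1.
have hu : h \in unitmx by rewrite unitmxE h1 unitr1.
have g1 : \det (h *m invmx h') = 1 by rewrite det_mulmx h1 det_inv h'1 mul1r invr1.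
have ghE : invmx (h *m invmx h') *m h = h'.
  rewrite -{2}[h](mulmxKV h'u) mulmxA mulVmx ?mul1mx//.
  by rewrite unitmxE g1 unitr1.
by rewrite -(mu_inv _ _ mH (@Hit_subSL R n h D) g1) rtrans_Hit// ghE.
Qed.

Lemma mu_Hit_le h D D' :
  measurable (Hit h D : set (Xspace R n)) ->
  measurable (Hit h D' : set (Xspace R n)) ->
  D `<=` D' -> (mu (Hit h D) <= mu (Hit h D'))%E.
Proof. by move=> mD mD' DD'; rewrite le_measure ?inE//; exact: HitS. Qed.

(** Left multiplication by the integral inverse of [gam] is continuous and preserves [A], so the
    closure of [A] is Gamma-invariant as well, and its complement in SL is open in the quotient. *)
Lemma closure_X_measurable (A : set 'M[R]_n) : Gamma_inv R n A ->
  measurable (closure A `&` SLset R n : set (Xspace R n)).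
Proof.
move=> [ASL AG].
have -> : closure A `&` SLset R n = SLset R n `\` (SLset R n `&` ~` closure A).
  by rewrite -setDE setDD setIC.
apply: measurableD; first by apply: X_open_measurable; exact: SL_X_open.
apply: X_open_measurable; split; last first.
  exists (~` closure A); split; last by rewrite setIC.
  by rewrite openC; exact: closed_closure.
split=> [x []//|gam g gam1 [g1 gA]].
split=> [|gamgA]; first by rewrite /SLset/= det_intmx_mul.
apply: gA => B gB.
have gE : intmx R n n (\adj gam) *m (intmx R n n gam *m g) *m 1%:M = g.
  by rewrite mulmx1 intmx_adjK.
have cont : intmx R n n (\adj gam) *m y *m 1%:M @[y --> intmx R n n gam *m g] --> g.
  by rewrite -[in X in _ --> X]gE; exact: mulmx2_continuous.
have [y [Ay By]] := gamgA _ (cont _ gB).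
exists (intmx R n n (\adj gam) *m y *m 1%:M); split=> //.
by rewrite mulmx1; exact: AG (det_adj1 gam1) Ay.
Qed.

Lemma rel_interior_Hit h D : open D -> rel_interior R n (Hit h D) = Hit h D.
Proof.
move=> oD; apply/seteqP; split=> [x []//|x Hx]; split=> //.
have [V oV HV] := Hit_rel_open h oD.
exists V; split=> //; rewrite -HV; split=> //.
by move: Hx; rewrite HV => -[].
Qed.

Lemma measurable_bdry_Hit h D : open D ->
  measurable (bdryX R n (Hit h D) : set (Xspace R n)).
Proof.
move=> oD; rewrite /bdryX rel_interior_Hit//.
apply: measurableD; last exact: measurable_Hit_open.
exact: closure_X_measurable (Hit_Gamma_inv h D).
Qed.

(** A lattice adherent to the hitting set has a nonzero vector in [closure D]: otherwise
    [near_notHit] would provide a neighbourhood that avoids the hitting set. *)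
Lemma bdry_Hit_sub h D D' (c : R) : \det h = 1 -> open D ->
  (forall v, D v -> `|v| <= c) -> closure D `<=` D' ->
  bdryX R n (Hit h D) `<=` Hit h D' `\` Hit h D.
Proof.
move=> h1 oD Dc DD'; rewrite /bdryX rel_interior_Hit// => x [[Hx x1] Hnx].
split=> //; split=> //; apply: contrapT => nz.
have nearHx : \forall y \near x, ~ Hit h D y.
  by apply: (near_notHit h1 x1 Dc) => z z0 Dz; apply: nz; exists z => //; exact: DD'.
by have [y [Hy nHy]] := Hx _ nearHx.
Qed.

(* Boundaries of the members of an increasing family are pairwise disjoint, so only countably many of them can have positive measure. *)
Lemma exists_null_bdry h (D : R -> set 'rV[R]_n) (a b c : R) :
  \det h = 1 -> a < b -> (forall e, a <= e <= b -> open (D e)) ->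
  (forall e, a <= e <= b -> forall v, D e v -> `|v| <= c) ->
  (forall e e', a <= e -> e < e' -> e' <= b -> closure (D e) `<=` D e') ->
  exists2 e, a < e < b & mu (bdryX R n (Hit h (D e))) = 0%E.
Proof.
move=> h1 ab oD Dc DD; apply: contrapT => nex.
(* Countability is read off from the monotone function [f]: the mass [j e] of the boundary bounds
   its jump at [e] from below. If all these masses were positive, every point of []a, b[] would be a
   discontinuity of [f], and the interval would be countable. *)
pose f e := fine (mu (Hit h (D e))).
have mD e : a <= e <= b -> measurable (Hit h (D e) : set (Xspace R n)).
  by move=> eab; apply: measurable_Hit_open; exact: oD.
have muE e : (mu (Hit h (D e))) = (f e)%:E \/ ~ (a <= e <= b).
  have [eab|] := pselect (a <= e <= b); [left|by right].
  by rewrite /f fineK// fin_num_measure//; exact: mD.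
pose j e := fine (mu (bdryX R n (Hit h (D e)))).
have jump e e' : a <= e -> e < e' -> e' <= b -> f e + j e <= f e'.
  move=> ae ee' e'b.
  have eab : a <= e <= b by lra.
  have e'ab : a <= e' <= b by lra.
  have [fe|//] := muE e; have [fe'|//] := muE e'.
  have mB := measurable_bdry_Hit h (oD e eab).
  have je : mu (bdryX R n (Hit h (D e))) = (j e)%:E.
    by rewrite /j fineK// fin_num_measure.
  rewrite -lee_fin EFinD -fe -je -fe' -measureU//; last first.
  - by rewrite /bdryX rel_interior_Hit ?setDIK//; exact: oD.
  - exact: mD.
  apply: le_measure; rewrite ?inE; [exact: measurableU (mD _ _) _|exact: mD|].
  have DDe := DD _ _ ae ee' e'b.
  rewrite subUset; split.
    by apply: HitS => v Dv; apply: DDe; exact: subset_closure.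
  by apply: subset_trans (bdry_Hit_sub h1 (oD e eab) (Dc e eab) DDe) _ => x [].
have j0 e : 0 <= j e by rewrite fine_ge0.
have jpos e : a < e < b -> 0 < j e.
  move=> eab; rewrite lt_neqAle j0 andbT eq_sym; apply/eqP => je.
  apply: nex; exists e => //; have mB := measurable_bdry_Hit h (oD e _).
  by rewrite -[LHS]fineK -/(j e) ?je// fin_num_measure//; apply: mB; lra.
have fle e e' : a <= e -> e <= e' -> e' <= b -> f e <= f e'.
  move=> ae; rewrite le_eqVlt => /predU1P[->//|ee' e'b].
  by have := jump _ _ ae ee' e'b; have := j0 e; lra.
have fnd : {in `[a, b]%R &, nondecreasing_fun f}.
  by move=> x y; rewrite !in_itv/= => /andP[ax _] /andP[_ yb] xy; exact: fle.
have disc e : a < e < b -> discontinuity f e.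
  move=> /[dup] eab /andP[ae eb].
  have cl : cvg (f x @[x --> e^'-]).
    apply: nondecreasing_at_left_is_cvgr.
      near=> z; move=> x y; rewrite !in_itv/= => xi yi xy; apply: fle => //; last lra.
      by have : a < z by []; lra.
    near=> z; exists (f b) => _ [y /= + <-]; rewrite in_itv/= => yi.
    by apply: fle => //; [have : a < z by []|]; lra.
  have cr : cvg (f x @[x --> e^'+]).
    apply: nondecreasing_at_right_is_cvgr.
      near=> z; move=> x y; rewrite !in_itv/= => xi yi xy; apply: fle => //; first lra.
      by have : z < b by []; lra.
    near=> z; exists (f a) => _ [y /= + <-]; rewrite in_itv/= => yi.
    by apply: fle => //; [|have : z < b by []]; lra.
  split=> //; rewrite lt_eqF//.
  have l1 : lim (f x @[x --> e^'-]) <= f e.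
    apply: limr_le => //; near=> x; apply: fle; [|by []|lra].
    by near: x; exact: nbhs_left_ge.
  have l2 : f e + j e <= lim (f x @[x --> e^'+]).
    apply: limr_ge => //; near=> x; apply: jump; [lra|by []|].
    by near: x; exact: nbhs_right_le.
  by have := jpos e eab; lra.
have := @discontinuity_countable R a b f fnd.
have -> : [set x | x \in `]a, b[%R /\ discontinuity f x] = `]a, b[%classic.
  apply/seteqP; split=> x /=; first by case.
  by rewrite in_itv/= => xab; split=> //; exact: disc.
move=> /countable_lebesgue_measure0.
rewrite lebesgue_measure_itv/= lte_fin ab -EFinD => /eqP; rewrite eqe; lra.
Unshelve. all: by end_near. Qed.

(** A fixed lattice has finitely many vectors of norm at most [c], and each of them lies outside
    [D i] from some index on, so the lattice cannot hit infinitely many of the [D i]. *)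
Lemma Hit_lim_sup0 h (D : nat -> set 'rV[R]_n) (c : R) : \det h = 1 ->
  (forall i v, D i v -> `|v| <= c) ->
  (forall v, \forall i \near \oo, ~ D i v) ->
  lim_sup_set (fun i => Hit h (D i)) = set0.
Proof.
move=> h1 Dc Dv; rewrite -subset0 => x Hx.
have x1 : \det x = 1 by have [i _ []] := Hx 0%N I.
have [Z nearZ] := near_lattice_finite c x1 h1.
have nearD : \forall i \near \oo, forall z, z \in Z -> ~ D i (intmx R 1 n z *m x *m h).
  apply: (@near_all_seq _ \oo _ _ Z
    (fun z i => ~ D i (intmx R 1 n z *m x *m h))) => z _; exact: Dv.
have [N _ ND] := nearD; have [i /= Ni [_ [z z0 Dz]]] := Hx N I.
apply: (ND i Ni z _ Dz); apply: (nbhs_singleton nearZ).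
exact: Dc Dz.
Qed.

End HitMeasure.

(** * Erosions, thickenings and weak convergence *)

Section ErodeThicken.
Variables (R : realType) (n : nat).
Implicit Types (O K : set 'rV[R]_n) (e : R).

(* The strict margin [e < e'] makes erosions open, so that [open_erode] needs no hypothesis on [O]. *)
Definition erode O e : set 'rV[R]_n :=
  [set v | exists2 e', e < e' & forall u, `|v - u| < e' -> O u].

Definition thicken K e : set 'rV[R]_n :=
  [set v | exists2 u, K u & `|v - u| < e].

Lemma erode_sub O e : 0 <= e -> erode O e `<=` O.
Proof. by move=> e0 v [e' ee']; apply; rewrite subrr normr0; lra. Qed.

Lemma open_erode O e : open (erode O e).
Proof.
rewrite openE => v [e' ee' e'O]; apply/mx_nbhsP.
exists ((e' - e) / 2); first lra.
move=> w vw; exists ((e' + e) / 2); first lra.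
move=> u wu; apply: e'O; have := ler_normD (v - w) (w - u).
by rewrite addrA subrK; lra.
Qed.

Lemma closure_erode O e e' : e < e' -> closure (erode O e') `<=` erode O e.
Proof.
move=> ee' v /(_ [set w | `|v - w| < (e' - e) / 2]) [|w [[e'' e'e'' e''O] vw]].
  by apply/mx_nbhsP; exists ((e' - e) / 2) => //; lra.
rewrite /= in vw; exists (e'' - (e' - e) / 2); first lra.
move=> u vu; apply: e''O; have := ler_normD (w - v) (v - u).
by rewrite addrA subrK (distrC w v); lra.
Qed.

Lemma erode_le O e e' : e <= e' -> erode O e' `<=` erode O e.
Proof. by move=> ee' v [e'' e'e'' e''O]; exists e'' => //; lra. Qed.

Lemma bigcup_erode O : open O -> \bigcup_i erode O i.+1%:R^-1 = O.
Proof.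
move=> oO; apply/seteqP; split=> [v [i _]|v Ov]; first exact: erode_sub.
have /mx_nbhsP[e e0 eO] := open_nbhs_nbhs (conj oO Ov).
near \oo => i; exists i => //; exists e => //.
by near: i; exact: (near_infty_natSinv_lt (PosNum e0)).
Unshelve. all: by end_near. Qed.

Lemma open_thicken K e : open (thicken K e).
Proof.
rewrite openE => v [u Ku vu]; apply/mx_nbhsP; exists (e - `|v - u|); first lra.
move=> w vw; exists u => //; have := ler_normD (w - v) (v - u).
by rewrite addrA subrK (distrC w v); lra.
Qed.

Lemma closure_thicken K e e' : e < e' -> closure (thicken K e) `<=` thicken K e'.
Proof.
move=> ee' v /(_ [set w | `|v - w| < e' - e]) [|w [[u Ku wu] vw]].
  by apply/mx_nbhsP; exists (e' - e) => //; lra.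
rewrite /= in vw; exists u => //; have := ler_normD (v - w) (w - u).
by rewrite addrA subrK; lra.
Qed.

Lemma thicken_le K e e' : e <= e' -> thicken K e `<=` thicken K e'.
Proof. by move=> ee' v [u Ku vu]; exists u => //; lra. Qed.

Lemma sub_thicken K e : 0 < e -> K `<=` thicken K e.
Proof. by move=> e0 v Kv; exists v => //; rewrite subrr normr0. Qed.

Lemma thicken_bounded K e (c : R) : (forall v, K v -> `|v| <= c) ->
  forall v, thicken K e v -> `|v| <= c + e.
Proof.
move=> Kc v [u Ku vu]; have := ler_normD u (v - u).
by rewrite addrC subrK; have := Kc u Ku; lra.
Qed.

End ErodeThicken.

(** * Approximation by sets with null boundary, and the squeeze *)

Section Approximation.
Variables (R : realType) (n : nat) (mu : probability (Xspace R n) R).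
Variable h : 'M[R]_n.
Hypothesis h1 : \det h = 1.

Lemma erode_approx (O : set 'rV[R]_n) (c a : R) : open O ->
  (forall v, O v -> `|v| <= c) -> (a%:E < mu (Hit h O))%E ->
  exists2 e, 0 < e & mu (bdryX R n (Hit h (erode O e))) = 0%E /\
    (a%:E < mu (Hit h (erode O e)))%E.
Proof.
move=> oO Oc aO; pose F i := Hit h (erode O i.+1%:R^-1).
have mF i : measurable (F i : set (Xspace R n)).
  by apply: measurable_Hit_open; exact: open_erode.
have cvgF : (mu \o F) i @[i --> \oo] --> mu (Hit h O).
  rewrite -[in X in _ --> X](bigcup_erode oO) Hit_bigcup.
  apply: nondecreasing_cvg_mu => //; first exact: bigcupT_measurable.
  move=> i j ij; apply/subsetPset/HitS/erode_le.
  by rewrite lef_pV2 ?posrE// ler_nat.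
have [i ai] : exists i, (a%:E < mu (F i))%E.
  by apply: (@filter_ex _ (\oo : set_system nat)); exact: cvgF _ (open_ereal_gt' aO).
pose b : R := i.+1%:R^-1.
have b0 : 0 < b by rewrite invr_gt0.
(* Erosions decrease in their parameter whereas [exists_null_bdry] expects an increasing family,
   hence the change of sign. Staying between [b / 2] and [b] keeps the erosion positive and its
   hitting set larger than [F i]. *)
have [e eb e_null] := @exists_null_bdry R n mu h (fun e => erode O (- e)) (- b)
   (- (b / 2)) c h1 ltac:(lra)
   (fun e _ => @open_erode _ _ O (- e))
   (fun e eb v Ov => Oc v (@erode_sub _ _ O (- e) ltac:(lra) v Ov))
   (fun e e' _ ee' _ => @closure_erode _ _ O (- e') (- e) ltac:(lra)).
exists (- e); first lra.
split=> //; apply: lt_le_trans ai _; apply: mu_Hit_le; first exact: mF.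
  by apply: measurable_Hit_open; exact: open_erode.
by apply: erode_le; rewrite -/b; lra.
Qed.

(** The delicate point is that hitting every thickening implies hitting [K], since different
    thickenings might be hit by different vectors. Boundedness excludes this: [Hit_lim_sup0] applies
    to the thickenings with [K] removed, because each vector outside the closed set [K] is at
    positive distance from it. *)
Lemma thicken_approx (K : set 'rV[R]_n) (c a : R) : closed K ->
  (forall v, K v -> `|v| <= c) -> (mu (Hit h K) < a%:E)%E ->
  exists2 e, 0 < e & mu (bdryX R n (Hit h (thicken K e))) = 0%E /\
    (mu (Hit h (thicken K e)) < a%:E)%E.
Proof.
move=> cK Kc Ka; pose F i := Hit h (thicken K i.+1%:R^-1).
have mF i : measurable (F i : set (Xspace R n)).
  by apply: measurable_Hit_open; exact: open_thicken.
have FE : \bigcap_i F i = Hit h K.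
  apply/seteqP; split=> [x Fx|x Kx i _]; last first.
    by apply: HitS Kx; apply: sub_thicken; rewrite invr_gt0.
  apply: contrapT => nKx.
  have : lim_sup_set (fun i => Hit h (thicken K i.+1%:R^-1 `\` K)) x.
    move=> i _; exists i => //=; have [x1 [z z0 Dz]] := Fx i I.
    by split=> //; exists z => //; split=> // Kz; apply: nKx; split=> //; exists z.
  rewrite (@Hit_lim_sup0 _ _ _ _ (c + 1))// => [i v [Kv _]|v].
    apply: (thicken_bounded Kc); apply: thicken_le Kv.
    by rewrite invf_le1// ler1n.
  have [Kv|nKv] := pselect (K v); first by apply: nearW => i [].
  have /mx_nbhsP[e e0 eK] := open_nbhs_nbhs (conj (closed_openC cK) nKv).
  near=> i => -[[u Ku vu] _]; apply: (eK u) Ku; apply: lt_trans vu _.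
  by near: i; exact: (near_infty_natSinv_lt (PosNum e0)).
have cvgF : (mu \o F) i @[i --> \oo] --> mu (Hit h K).
  rewrite -FE; apply: nonincreasing_cvg_mu => //.
  - by rewrite -ge0_fin_numE// fin_num_measure.
  - exact: bigcapT_measurable.
  - move=> i j ij; apply/subsetPset/HitS/thicken_le.
    by rewrite lef_pV2 ?posrE// ler_nat.
have [i ai] : exists i, (mu (F i) < a%:E)%E.
  by apply: (@filter_ex _ (\oo : set_system nat)); exact: cvgF _ (open_ereal_lt' Ka).
pose b : R := i.+1%:R^-1.
have b0 : 0 < b by rewrite invr_gt0.
have Kb e : b / 2 <= e <= b -> forall v, thicken K e v -> `|v| <= c + b.
  by move=> eb v Kv; have := thicken_bounded Kc Kv; lra.
have [e eb e_null] := @exists_null_bdry R n mu h (thicken K) (b / 2) b (c + b)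
  h1 ltac:(lra) (fun e _ => @open_thicken _ _ K e)
  Kb
  (fun e e' _ ee' _ => @closure_thicken _ _ K e e' ee').
exists e; first lra.
split=> //; apply: le_lt_trans ai; apply: mu_Hit_le; last first.
- by apply: thicken_le; rewrite -/b; lra.
- exact: mF.
- by apply: measurable_Hit_open; exact: open_thicken.
Unshelve. all: by end_near. Qed.

Variables (lam : probability (Xspace R n) R) (phi : R -> 'M[R]_n).
Hypothesis phi1 : forall t, \det (phi t) = 1.
Hypothesis lam_adm : forall E : set (Xspace R n),
  measurable E -> E `<=` SLset R n -> mu (bdryX R n E) = 0%E ->
  lam (rtrans R n E (phi t)) @[t --> +oo] --> mu E.

(** Given an error [e], one erosion of [O] and one thickening of [K] are fixed before [T] varies, so
    admissibility applies to two fixed sets. Since [O] and [K] share the hitting measure [p], both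
    limits lie within [e] of [p] on the required side. *)
Lemma sandwich_cvg (O K : set 'rV[R]_n) (c : R) (p : R)
    (A : R -> set (Xspace R n)) (t : R -> R) :
  open O -> (forall v, O v -> `|v| <= c) ->
  closed K -> (forall v, K v -> `|v| <= c) ->
  mu (Hit h O) = p%:E -> mu (Hit h K) = p%:E ->
  t T @[T --> +oo] --> +oo ->
  (forall T, measurable (A T)) ->
  (forall e, 0 < e -> \forall T \near +oo,
     rtrans R n (Hit h (erode O e)) (phi (t T)) `<=` A T) ->
  (forall e, 0 < e -> \forall T \near +oo,
     A T `<=` rtrans R n (Hit h (thicken K e)) (phi (t T))) ->
  lam (A T) @[T --> +oo] --> p%:E.
Proof.
move=> oO Oc cK Kc Op Kp ty mA lowA upA.
have mrt D T : open D -> measurable (rtrans R n (Hit h D) (phi (t T)) : set (Xspace R n)).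
  by move=> oD; rewrite rtrans_Hit//; exact: measurable_Hit_open.
apply/fine_cvgP; split; first by apply: nearW => T; rewrite fin_num_measure.
apply/cvgrPdist_lt => e e0.
have [a a0 [a_null aO]] : exists2 a, 0 < a & mu (bdryX R n (Hit h (erode O a))) = 0%E /\
    ((p - e)%:E < mu (Hit h (erode O a)))%E.
  by apply: (erode_approx oO Oc); rewrite Op lte_fin; lra.
have [b b0 [b_null Kb]] : exists2 b, 0 < b & mu (bdryX R n (Hit h (thicken K b))) = 0%E /\
    (mu (Hit h (thicken K b)) < (p + e)%:E)%E.
  by apply: (thicken_approx cK Kc); rewrite Kp lte_fin; lra.
have mOa := measurable_Hit_open h (@open_erode _ _ O a).
have mKb := measurable_Hit_open h (@open_thicken _ _ K b).
have lowlim := lam_adm mOa (@Hit_subSL _ _ _ _) a_null.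
have uplim := lam_adm mKb (@Hit_subSL _ _ _ _) b_null.
have nearlow : \forall T \near +oo,
    ((p - e)%:E < lam (rtrans R n (Hit h (erode O a)) (phi (t T))))%E.
  have cl := cvg_comp _ _ ty lowlim.
  exact: cl _ (open_ereal_gt' aO).
have nearup : \forall T \near +oo,
    (lam (rtrans R n (Hit h (thicken K b)) (phi (t T))) < (p + e)%:E)%E.
  have cl := cvg_comp _ _ ty uplim.
  exact: cl _ (open_ereal_lt' Kb).
near=> T.
have l1 : ((p - e)%:E < lam (A T))%E.
  apply: (@lt_le_trans _ _ (lam (rtrans R n (Hit h (erode O a)) (phi (t T))))).
    by near: T.
  apply: le_measure; rewrite ?inE//; first by apply: mrt; exact: open_erode.
  by near: T; exact: lowA.
have l2 : (lam (A T) < (p + e)%:E)%E.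
  apply: (@le_lt_trans _ _ (lam (rtrans R n (Hit h (thicken K b)) (phi (t T))))).
    apply: le_measure; rewrite ?inE//; first by apply: mrt; exact: open_thicken.
    by near: T; exact: upA.
  by near: T.
rewrite ltr_norml; move: l1 l2; rewrite -(@fineK _ (lam (A T))) ?fin_num_measure//.
by rewrite !lte_fin /=; lra.
Unshelve. all: by end_near. Qed.

End Approximation.

(** * Norms, and lattices meeting a hyperplane *)

Section NormEquivalence.
Variables (R : realType) (p : nat) (N : 'rV[R]_p -> R).
Hypothesis hN : is_norm R p N.

Lemma is_norm_ge0 x : 0 <= N x. Proof. by case: hN. Qed.

Lemma is_normZ a x : N (a *: x) = `|a| * N x. Proof. by case: hN => _ [_ []]. Qed.

Lemma is_norm_add x y : N (x + y) <= N x + N y. Proof. by case: hN => _ [_ []]. Qed.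

Lemma is_norm0 : N 0 = 0.
Proof. by rewrite -(scale0r (0 : 'rV[R]_p)) is_normZ normr0 mul0r. Qed.

Lemma is_norm_sub x y : N (x - y) <= N x + N y.
Proof. by rewrite (le_trans (is_norm_add _ _))// -scaleN1r is_normZ normrN1 mul1r. Qed.

Lemma is_norm_le_mx_norm : exists2 c : R, 0 < c & forall x, N x <= c * `|x|.
Proof.
exists (\sum_(i < p) N (delta_mx 0 i) + 1).
  by rewrite ltr_wpDl// sumr_ge0// => i _; exact: is_norm_ge0.
move=> x; rewrite mulrDl mul1r ler_wpDr// mulr_suml {1}(row_sum_delta x).
apply: (@le_trans _ _ (\sum_(j < p) N (x 0 j *: delta_mx 0 j))).
  elim/big_rec2 : _ => [|j a b _ ab]; first by rewrite is_norm0.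
  by rewrite (le_trans (is_norm_add _ _))// lerD2l.
by apply: ler_sum => j _; rewrite is_normZ mulrC ler_wpM2l ?is_norm_ge0// mx_entry_le_norm.
Qed.

Lemma is_norm_continuous : continuous N.
Proof.
have [c c0 Nc] := is_norm_le_mx_norm.
move=> x A /nbhs_ballP[e /= e0 eA]; apply/mx_nbhsP.
exists (e / c); first by rewrite divr_gt0.
move=> y; rewrite ltr_pdivlMr// => xy; apply: eA; rewrite /ball/=.
have Nxy : N (x - y) < e by apply: le_lt_trans xy; rewrite mulrC.
have Nyx : N (y - x) < e by apply: le_lt_trans (Nc _) _; rewrite distrC mulrC.
have := is_norm_add (x - y) y; have := is_norm_add (y - x) x.
by rewrite !subrK ltr_norml; lra.
Qed.

Lemma mx_norm_le_is_norm : exists2 c : R, 0 < c & forall x, `|x| <= c * N x.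
Proof.
pose S := [set x : 'rV[R]_p | `|x| = 1].
(* If the unit sphere is empty, every vector is 0 and any constant will do. *)
have [S0|nS] := pselect (S !=set0); last first.
  exists 1 => // x; have [->|x0] := eqVneq x 0; first by rewrite normr0 mul1r is_norm_ge0.
  exfalso; apply: nS; exists (`|x|^-1 *: x); rewrite /S/= normrZ normfV normr_id.
  by rewrite mulVf// normr_eq0.
have cS : compact S.
  apply: bounded_closed_compact.
    by exists 1; split=> // M M1 x /= ->; exact: ltW.
  have -> : S = (fun x : 'rV[R]_p => `|x|) @^-1` [set 1] by [].
  by apply: closed_comp => [x _|]; [exact: norm_continuous|exact: closed_eq].
have [a /set_mem aS aN] := EVT_min_rV S0 cS (continuous_subspaceT is_norm_continuous).
have Na : 0 < N a.
  rewrite lt_neqAle is_norm_ge0 andbT eq_sym; apply/eqP => Na0.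
  case: hN => _ [/(_ _ Na0) a0 _]; move: aS; rewrite /S/= a0 normr0 => /eqP.
  by rewrite eq_sym oner_eq0.
exists (N a)^-1; first by rewrite invr_gt0.
move=> x; rewrite mulrC ler_pdivlMr//.
have [->|x0] := eqVneq x 0; first by rewrite normr0 mul0r is_norm_ge0.
have x0' : 0 < `|x| by rewrite normr_gt0.
have := aN (`|x|^-1 *: x); rewrite is_normZ normfV normr_id.
rewrite mulrC ler_pdivlMr// mulrC; apply; rewrite inE /S/= normrZ normfV normr_id.
by rewrite mulVf// normr_eq0.
Qed.

Lemma open_is_norm_lt r : open [set x | N x < r].
Proof.
by apply: (@open_comp _ _ N [set y | y < r]) => [x _|]; [exact: is_norm_continuous|exact: open_lt].
Qed.

Lemma compact_is_norm_le r : compact [set x | N x <= r].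
Proof.
apply: bounded_closed_compact.
  have [c c0 Nc] := mx_norm_le_is_norm.
  exists (c * r); split; first exact: num_real.
  by move=> M rM x /= xr; apply: (le_trans (Nc x)); rewrite (le_trans _ (ltW rM))// ler_pM2l.
by apply: (@closed_comp _ _ N [set y | y <= r]) => [x _|]; [exact: is_norm_continuous|exact: closed_le].
Qed.

End NormEquivalence.

(** * Lattices with a nonzero vector in a hyperplane form a null set *)

Section Hyperplane.
Variables (R : realType) (n : nat) (mu : probability (Xspace R n.+1) R).
Hypothesis mu_inv : right_invariant R n.+1 mu.

Definition shear (j : 'I_n.+1) (c : R) : 'M[R]_n.+1 :=
  1%:M + c *: delta_mx j ord_max.

Lemma mul_shear j c (v : 'rV[R]_n.+1) i :
  (v *m shear j c) 0 i = v 0 i + (i == ord_max)%:R * (c * v 0 j).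
Proof.
rewrite mulmxDr mulmx1 mxE -scalemxAr; congr (_ + _).
rewrite !mxE (bigD1 j)//= mxE eqxx/= big1 => [|l lj]; last first.
  by rewrite mxE (negbTE lj) mulr0.
by rewrite addr0 mulrA mulrC.
Qed.

Lemma det_shear j c : j != ord_max -> \det (shear j c) = 1.
Proof.
move=> jn; rewrite -det_tr det_trig; last first.
  apply/is_trig_mxP => a b ab; rewrite !mxE.
  have -> : (b == a) = false by apply/negbTE; rewrite neq_ltn ab orbT.
  have -> : (a == ord_max) = false.
    by apply/negbTE; rewrite neq_ltn (leq_trans ab)// -ltnS ltn_ord.
  by rewrite andbF !(mulr0, addr0).
rewrite big1// => i _; rewrite !mxE eqxx; case: eqP => [->|]; last first.
  by rewrite /= mulr0 addr0.
by rewrite (negbTE jn)/= mulr0 addr0.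
Qed.

(* The shears v_n -> v_n + c_l v_j preserve mu, but for fixed v with v_j <> 0 only finitely many of them can move v into the hyperplane; so mu (Hit h D) is bounded by the measure of an empty limsup. *)
Lemma Hit_hyperplane_slice0 h (D : set 'rV[R]_n.+1) (j : 'I_n.+1) (c d : R) :
  \det h = 1 -> closed D -> (forall v, D v -> `|v| <= c) -> 0 < d ->
  j != ord_max -> (forall v, D v -> v 0 ord_max = 0 /\ d <= `|v 0 j|) ->
  mu (Hit h D) = 0%E.
Proof.
move=> h1 cD Dc d0 jn Dv.
pose u (l : nat) := shear j (- l.+1%:R^-1).
pose F l := Hit (u l) D.
have mH g : \det g = 1 -> measurable (Hit g D : set (Xspace R n.+1)).
  by move=> g1; exact: measurable_Hit_closed cD Dc.
have u1 l : \det (u l) = 1 by exact: det_shear.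
have FE l : mu (F l) = mu (Hit h D).
  by rewrite /F; apply: Hit_invariant => //; exact: mH.
have F0 : lim_sup_set F = set0.
  pose E l := [set v : 'rV[R]_n.+1 | D (v *m u l)].
  have -> : F = (fun l => Hit 1%:M (E l)).
    apply/funext => l; apply/seteqP.
    by split=> x [x1 [z z0 Dz]]; split=> //; exists z => //; move: Dz; rewrite /E/= mulmx1.
  (* Undoing a shear with coefficient at most 1 changes the last entry by at most [c], hence the
     bound [2 * c]. *)
  apply: (@Hit_lim_sup0 _ _ _ _ (2 * c)); first exact: det1.
    move=> l v; rewrite /E/= => /Dc vc.
    have vi i : `|(v *m u l) 0 i| <= c by apply: le_trans vc; exact: mx_entry_le_norm.
    have c0 : 0 <= c by rewrite (le_trans _ vc).
    have l1 : `|l.+1%:R^-1 : R| <= 1 by rewrite ger0_norm// invf_le1// ler1n.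
    apply: mx_norm_le_entry => [|a i]; first lra.
    rewrite (ord1 a); have := vi i; have := vi j; rewrite !mul_shear (negbTE jn) mul0r addr0.
    move=> vj; case: eqP => _; rewrite ?mul0r ?addr0; last lra.
    rewrite mul1r mulNr => vin; have := ler_normD (v 0 i - l.+1%:R^-1 * v 0 j) (l.+1%:R^-1 * v 0 j).
    rewrite subrK normrM; have := normr_ge0 (v 0 j); have := normr_ge0 (l.+1%:R^-1 : R).
    nra.
  move=> v; have [v0|v0] := eqVneq (v 0 j) 0.
    apply: nearW => l; rewrite /E/= => /Dv[_].
    by rewrite mul_shear (negbTE jn) mul0r addr0 v0 normr0; lra.
  (* Membership in [E l] forces [v_n / v_j = 1 / (l + 1)], which is impossible for a nonpositive
     ratio, and for a positive one as soon as [l] is large. *)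
  have [q0|q0] := lerP (v 0 ord_max / v 0 j) 0.
    apply: nearW => l; rewrite /E/= => /Dv[+ _].
    rewrite mul_shear eqxx mul1r mulNr => /eqP; rewrite subr_eq0 => /eqP vE.
    by move: q0; rewrite vE mulfK// leNgt invr_gt0 ltr0n.
  near=> l; rewrite /E/= => /Dv[+ _].
  rewrite mul_shear eqxx mul1r mulNr => /eqP; rewrite subr_eq0 => /eqP vE.
  have : l.+1%:R^-1 < v 0 ord_max / v 0 j.
    by near: l; exact: (near_infty_natSinv_lt (PosNum q0)).
  by rewrite vE mulfK// ltxx.
have mF l : measurable (F l : set (Xspace R n.+1)) by apply: mH; exact: u1.
have limF : mu (\bigcup_(k >= l) F k) @[l --> \oo] --> 0%E.
  rewrite -(measure0 mu) -F0; apply: lim_sup_set_cvg => //.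
  rewrite -ge0_fin_numE// fin_num_measure//.
  by apply: bigcup_measurable => k _; exact: mF.
apply/eqP; rewrite eq_le measure_ge0 andbT; apply: (cvge_to_ge limF).
apply: nearW => l; rewrite -(FE l); apply: le_measure; rewrite ?inE//.
  by apply: bigcup_measurable => k _; exact: mF.
by move=> x Fx; exists l => //=.
Unshelve. all: by end_near. Qed.

(** A nonzero vector of the hyperplane has a nonzero entry other than the last one, so apart from 0
    the set [D] is a countable union of slices on which some such entry is bounded away from 0. The
    vector 0 is never hit, because [x] and [h] are invertible. *)
Lemma Hit_hyperplane0 h (D : set 'rV[R]_n.+1) (c : R) :
  \det h = 1 -> closed D -> (forall v, D v -> `|v| <= c) ->
  (forall v, D v -> v 0 ord_max = 0) -> mu (Hit h D) = 0%E.
Proof.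
move=> h1 cD Dc Dv.
pose D' (j : 'I_n.+1) (i : nat) := D `&` [set v | i.+1%:R^-1 <= `|v 0 j|].
have cD' j i : closed (D' j i).
  apply: closedI => //.
  apply: (@closed_comp _ _ (fun v : 'rV[R]_n.+1 => `|v 0 j|) [set y | i.+1%:R^-1 <= y]).
    move=> v _; apply: (@continuous_comp _ _ _ (fun v : 'rV[R]_n.+1 => v 0 j) (fun y => `|y|)).
      exact: coord_continuous.
    exact: norm_continuous.
  exact: closed_ge.
have mD' j i : measurable (Hit h (D' j i) : set (Xspace R n.+1)).
  by apply: (measurable_Hit_closed (c := c) h1 (cD' j i)) => v [Dv' _]; exact: Dc.
have D'0 j i : mu (Hit h (D' j i)) = 0%E.
  have [jn|jn] := eqVneq j ord_max.
    rewrite (_ : Hit h _ = set0) ?measure0//; rewrite -subset0 => x [_ [z _ [/Dv + /=]]].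
    by rewrite jn => ->; rewrite normr0 leNgt invr_gt0 ltr0n.
  apply: (@Hit_hyperplane_slice0 h _ j c i.+1%:R^-1 h1 (cD' j i)) => //.
  - by move=> v [/Dc].
  - by move=> v [/Dv].
have HE : Hit h D `<=` \bigcup_j \bigcup_i Hit h (D' (inord j) i).
  move=> x [x1 [z z0 Dz]].
  have [v0|/rV0Pn[j vj]] := eqVneq (intmx R 1 n.+1 z *m x *m h) 0.
    have := intmx_ge1 R z0; suff -> : intmx R 1 n.+1 z = 0 by rewrite normr0; lra.
    apply: (can_inj (@mulmxK _ _ _ x _)); first by rewrite unitmxE x1 unitr1.
    apply: (can_inj (@mulmxK _ _ _ h _)); first by rewrite unitmxE h1 unitr1.
    by rewrite v0 !mul0mx.
  exists j => //; rewrite inord_val.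
  have vj0 : 0 < `|(intmx R 1 n.+1 z *m x *m h) 0 j| by rewrite normr_gt0.
  near \oo => i; exists i => //; split=> //; exists z => //; split=> //=; apply: ltW.
  by near: i; exact: (near_infty_natSinv_lt (PosNum vj0)).
apply/negligibleP; first exact: measurable_Hit_closed h1 cD Dc.
apply: (@negligibleS _ (Xspace R n.+1) _ _ _ _ HE); apply: negligible_bigcup => j.
apply: negligible_bigcup => i; apply/negligibleP; [exact: mD'|exact: D'0].
Unshelve. all: by end_near. Qed.

End Hyperplane.

(** * Coordinates *)

Section Coordinates.
Variables (R : realType) (k m : nat).
Implicit Types (v w : 'rV[R]_(k + m).+1).

(** The inverse of the splitting into [yk] and [pr]; the last coordinate belongs to the second
    part. *)
Definition mkv (a : 'rV[R]_k) (w : 'rV[R]_m.+1) : 'rV[R]_(k + m).+1 :=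
  \row_i if (i < k)%N then sn R k a i else w 0 (inord (i - k)).

Lemma ykE v (i : 'I_k) (j : 'I_(k + m).+1) : i = j :> nat -> yk R k m v 0 i = v 0 j.
Proof.
move=> ij; rewrite mxE; congr (v 0 _); apply: val_inj; rewrite val_insubd /= -ij ifT//.
by have := ltn_ord i; lia.
Qed.

Lemma prE v (i : 'I_m.+1) (j : 'I_(k + m).+1) :
  (k + i)%N = j :> nat -> pr R k m v 0 i = v 0 j.
Proof.
move=> ij; rewrite mxE; congr (v 0 _); apply: val_inj.
by rewrite val_insubd /= -ij ifT//; have := ltn_ord i; lia.
Qed.

Lemma entry_cases (P : 'I_(k + m).+1 -> Prop) :
  (forall (i : 'I_k) (j : 'I_(k + m).+1), i = j :> nat -> P j) ->
  (forall (i : 'I_m.+1) (j : 'I_(k + m).+1), (k + i)%N = j :> nat -> P j) ->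
  forall j, P j.
Proof.
move=> P1 P2 j; have [jk|kj] := ltnP j k; first exact: (P1 (Ordinal jk)).
apply: (P2 (inord (j - k))); rewrite inordK; last by have := ltn_ord j; lia.
by lia.
Qed.

Lemma yk_pr_inj v w : yk R k m v = yk R k m w -> pr R k m v = pr R k m w -> v = w.
Proof.
move=> ykE' prE'; apply/rowP; apply: entry_cases => i j ij.
  by rewrite -!(ykE _ ij) ykE'.
by rewrite -!(prE _ ij) prE'.
Qed.

Lemma sn_ord p (a : 'rV[R]_p) (i : 'I_p) : sn R p a i = a 0 i.
Proof. by rewrite /sn valK. Qed.

Lemma yk_mkv a (w : 'rV[R]_m.+1) : yk R k m (mkv a w) = a.
Proof.
apply/rowP => i; have ij : i = widen_ord (leqW (leq_addr m k)) i :> nat by [].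
by rewrite (ykE _ ij) mxE /= ltn_ord sn_ord.
Qed.

Lemma pr_mkv a (w : 'rV[R]_m.+1) : pr R k m (mkv a w) = w.
Proof.
apply/rowP => i; have ki : (k + i < (k + m).+1)%N by have := ltn_ord i; lia.
rewrite (@prE _ i (Ordinal ki))// mxE /= ifF; last by lia.
by rewrite addKn inord_val.
Qed.

Lemma ylastE v : ylast R k m v = pr R k m v 0 ord_max.
Proof. by rewrite (@prE v ord_max ord_max). Qed.

Lemma ykB v w : yk R k m (v - w) = yk R k m v - yk R k m w.
Proof. by apply/rowP => i; rewrite !mxE. Qed.

Lemma prB v w : pr R k m (v - w) = pr R k m v - pr R k m w.
Proof. by apply/rowP => i; rewrite !mxE. Qed.

Lemma ykZ a v : yk R k m (a *: v) = a *: yk R k m v.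
Proof. by apply/rowP => i; rewrite !mxE. Qed.

Lemma prZ a v : pr R k m (a *: v) = a *: pr R k m v.
Proof. by apply/rowP => i; rewrite !mxE. Qed.

Lemma yk_norm_le v : `|yk R k m v| <= `|v|.
Proof.
by apply: mx_norm_le_entry => // i j; rewrite mxE; exact: mx_entry_le_norm.
Qed.

Lemma pr_norm_le v : `|pr R k m v| <= `|v|.
Proof.
by apply: mx_norm_le_entry => // i j; rewrite mxE; exact: mx_entry_le_norm.
Qed.

Lemma norm_le_yk_pr v : `|v| <= `|yk R k m v| + `|pr R k m v|.
Proof.
apply: mx_norm_le_entry => [|a]; first by rewrite addr_ge0.
rewrite (ord1 a); apply: entry_cases => i j ij.
  by rewrite -(ykE _ ij) ler_wpDr// mx_entry_le_norm.
by rewrite -(prE _ ij) ler_wpDl// mx_entry_le_norm.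
Qed.

Lemma yk_continuous : continuous (yk R k m).
Proof.
apply: (@lipschitz_continuous_mx _ _ _ _ _ _ 1) => x y.
by rewrite -ykB mul1r yk_norm_le.
Qed.

Lemma pr_continuous : continuous (pr R k m).
Proof.
apply: (@lipschitz_continuous_mx _ _ _ _ _ _ 1) => x y.
by rewrite -prB mul1r pr_norm_le.
Qed.

Lemma mkv_pr_continuous a : continuous (fun v => mkv a (pr R k m v)).
Proof.
apply: (@lipschitz_continuous_mx _ _ _ _ _ _ 1) => x y.
rewrite (le_trans (norm_le_yk_pr _))// ykB prB !yk_mkv !pr_mkv subrr normr0.
by rewrite add0r mul1r -prB pr_norm_le.
Qed.

Lemma mul_Umx v s j : (v *m Umx R k m s) 0 j =
  v 0 j - (if (j < k)%N then ylast R k m v * sn R k s j else 0).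
Proof.
have -> : Umx R k m s = 1%:M - \matrix_(i, j)
    (if (i == ord_max) && (j < k)%N then sn R k s j else 0).
  apply/matrixP => a b; rewrite !mxE; case: eqP => [->|_] /=; last by rewrite subr0.
  have [bk|bk] := ltnP b k; last by rewrite subr0 eq_sym.
  have -> : (ord_max == b) = false by apply/negbTE; rewrite neq_ltn /=; lia.
  by rewrite sub0r.
rewrite mulmxBr mulmx1 !mxE; congr (_ - _).
rewrite (bigD1 ord_max)//= mxE eqxx/= big1 ?addr0 => [|i imax]; last first.
  by rewrite mxE (negbTE imax)/= mulr0.
by case: ifP => //; rewrite mulr0.
Qed.

Lemma yk_mul_Umx v s : yk R k m (v *m Umx R k m s) = yk R k m v - ylast R k m v *: s.
Proof.
apply/rowP => i; have ij : i = widen_ord (leqW (leq_addr m k)) i :> nat by [].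
by rewrite (ykE _ ij) mul_Umx /= ltn_ord sn_ord !mxE -(ykE _ ij) mxE.
Qed.

Lemma pr_mul_Umx v s : pr R k m (v *m Umx R k m s) = pr R k m v.
Proof.
apply/rowP => i; have ki : (k + i < (k + m).+1)%N by have := ltn_ord i; lia.
rewrite !(@prE _ i (Ordinal ki))// mul_Umx /= ifF ?subr0//; lia.
Qed.

Lemma yk_mul_Phimx v t :
  yk R k m (v *m Phimx R k m t) = expR (m.+1%:R * t) *: yk R k m v.
Proof.
apply/rowP => i; have ij : i = widen_ord (leqW (leq_addr m k)) i :> nat by [].
by rewrite (ykE _ ij) mul_mx_diag !mxE /= ltn_ord mulrC -(ykE _ ij) mxE.
Qed.

Lemma pr_mul_Phimx v t :
  pr R k m (v *m Phimx R k m t) = expR (- (k%:R * t)) *: pr R k m v.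
Proof.
apply/rowP => i; have ki : (k + i < (k + m).+1)%N by have := ltn_ord i; lia.
rewrite (@prE _ i (Ordinal ki))// mul_mx_diag !mxE /= ifF; last by lia.
by rewrite mulrC -(@prE _ i (Ordinal ki))// mxE.
Qed.

Lemma ylast_mul_Phimx v t :
  ylast R k m (v *m Phimx R k m t) = expR (- (k%:R * t)) * ylast R k m v.
Proof. by rewrite !ylastE pr_mul_Phimx mxE. Qed.

Lemma PhimxD t u : Phimx R k m t *m Phimx R k m u = Phimx R k m (t + u).
Proof.
apply/matrixP => a b; rewrite mul_diag_mx !mxE; case: eqP => [->|_]; last first.
  by rewrite !mulr0n mulr0.
by rewrite !mulr1n; case: ifP => _; rewrite -expRD; congr expR; ring.
Qed.

Lemma Phimx0 : Phimx R k m 0 = 1%:M.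
Proof.
apply/matrixP => a b; rewrite !mxE; case: eqP => // _.
by case: ifP => _; rewrite mulr0 ?oppr0 expR0.
Qed.

Lemma det_Phimx t : \det (Phimx R k m t) = 1.
Proof.
rewrite det_diag; under eq_bigr do rewrite mxE.
rewrite -(big_mkord predT (fun i => if (i < k)%N then expR (m.+1%:R * t)
  else expR (- (k%:R * t)))) -addnS (big_cat_nat _ (n := k))//= ?leq_addr//.
rewrite (@eq_big_nat _ _ _ 0 k _ (fun=> expR (m.+1%:R * t))); last first.
  by move=> i ik; rewrite ifT//; case/andP: ik.
rewrite (@eq_big_nat _ _ _ k _ _ (fun=> expR (- (k%:R * t)))); last first.
  by move=> i ki; rewrite ifF//; apply/negbTE; rewrite -leqNgt; case/andP: ki.
rewrite !prodr_const_nat subn0 addKn -!expRM_natl -expRD.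
by rewrite -[RHS]expR0; congr expR; ring.
Qed.

Lemma det_phimx g0 t : \det g0 = 1 -> \det (phimx R k m g0 t) = 1.
Proof.
by move=> g1; rewrite !det_mulmx det_Phimx det_inv g1 invr1 !mulr1.
Qed.

(** The conjugation by [g0] in the flow cancels against the base point [g0], so the flow acts on the
    vectors themselves through [Phi(-t)]. *)
Lemma rtrans_Hit_phimx g0 D t : \det g0 = 1 ->
  rtrans R (k + m).+1 (Hit g0 D) (phimx R k m g0 t) = Hit (g0 *m Phimx R k m (- t)) D.
Proof.
move=> g1; have gu : g0 \in unitmx by rewrite unitmxE g1 unitr1.
rewrite rtrans_Hit; last exact: det_phimx.
have pu : phimx R k m g0 t \in unitmx by rewrite unitmxE det_phimx// unitr1.
suff -> : invmx (phimx R k m g0 t) *m g0 = g0 *m Phimx R k m (- t) by [].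
apply: (can_inj (mulKmx pu)); rewrite mulKVmx// /phimx !mulmxA mulmxKV//.
by rewrite -mulmxA PhimxD subrr Phimx0 mulmx1.
Qed.

End Coordinates.

(** * Cones *)

Lemma continuous_scale_sub (R : realType) (T : topologicalType) (f g : T -> R) (a : R) :
  continuous f -> continuous g -> continuous (fun v => a * f v - g v).
Proof. by move=> cf cg v; exact: cvgB (cvgM (cvg_cst a) (cf v)) (cg v). Qed.

Section Cones.
Variables (R : realType) (k m : nat).
Local Notation n := ((k + m).+1).
Variables (normk : 'rV[R]_k -> R) (normn : 'rV[R]_n -> R).
Hypotheses (hk : (0 < k)%N) (hnormk : is_norm R k normk)
  (hnormn : is_norm R n normn).
Variable g0 : 'M[R]_n.
Hypothesis hg0 : \det g0 = 1.

Let g0u : g0 \in unitmx. Proof. by rewrite unitmxE hg0 unitr1. Qed.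

(** The norm whose closed unit ball is the given ball times [g0], so that [W] is the projection of
    the part of this ball where [y_n > 0]. *)
Definition qnorm (v : 'rV[R]_n) : R := normn (v *m invmx g0).

Lemma is_norm_qnorm : is_norm R n qnorm.
Proof.
split=> [x|]; first exact: (is_norm_ge0 hnormn).
split=> [x qx|].
  have [_ [h _]] := hnormn; rewrite -(mulmxKV g0u x) (h _ qx) mul0mx//.
split=> [a x|x y]; first by rewrite /qnorm -scalemxAl (is_normZ hnormn).
by rewrite /qnorm mulmxDl (is_norm_add hnormn).
Qed.

Definition Acone (X : R) : set 'rV[R]_n :=
  cone R k m [set a | normk a <= X] (Wset R k m normn g0).

Definition Ocone (X : R) : set 'rV[R]_n :=
  [set v | 0 < ylast R k m v /\ normk (yk R k m v) < X * ylast R k m v /\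
    exists y, qnorm y < 1 /\ pr R k m y = pr R k m v].

(* Double cone: the symmetric closure of [Acone X] together with its slice [y_n = 0]; being symmetric, it costs nothing for the hitting sets, which only see lattice vectors up to sign. *)
Definition Kcone (X : R) : set 'rV[R]_n :=
  [set v | normk (yk R k m v) <= X * `|ylast R k m v| /\
    exists y, qnorm y <= 1 /\ pr R k m y = pr R k m v].

Lemma AconeE X : Acone X = Kcone X `&` [set v | 0 < ylast R k m v].
Proof.
apply/seteqP; split=> v.
  move=> [[a /= aX va] [y [[b b1 yb] y0] yv]].
  have v0 : 0 < ylast R k m v by rewrite ylastE -yv -ylastE.
  split=> //; split.
    by rewrite va (is_normZ hnormk) mulrC ler_wpM2r.
  by exists y; split=> //; rewrite /qnorm yb mulmxK.
move=> [[vX [y [y1 yv]]] /= v0]; split.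
  exists ((ylast R k m v)^-1 *: yk R k m v) => /=.
    rewrite (is_normZ hnormk) normfV gtr0_norm// mulrC ler_pdivrMr//.
    by rewrite gtr0_norm in vX.
  by rewrite scalerA mulfV ?scale1r// gt_eqF.
exists y => //; split; last by rewrite /= ylastE yv -ylastE.
by exists (y *m invmx g0) => //; rewrite mulmxKV.
Qed.

Lemma Ocone_sub X : Ocone X `<=` Acone X.
Proof.
rewrite AconeE => v [v0 [vX [y [y1 yv]]]]; split=> //; split.
  by rewrite gtr0_norm// ltW.
by exists y; split=> //; exact: ltW.
Qed.

Lemma Acone_sub_Kcone X : Acone X `<=` Kcone X.
Proof. by rewrite AconeE => v []. Qed.

Lemma ylast_continuous : continuous (ylast R k m).
Proof. exact: coord_continuous. Qed.

Lemma normk_yk_continuous : continuous (fun v => normk (yk R k m v)).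
Proof.
move=> v; apply: (@continuous_comp _ _ _ (yk R k m) normk).
  exact: yk_continuous.
exact: is_norm_continuous.
Qed.

(** The existential over [y] only concerns its first block, [pr y] being prescribed; it becomes a
    union over that block of preimages of the open ball. *)
Lemma open_Ocone X : open (Ocone X).
Proof.
have -> : Ocone X = [set v | 0 < ylast R k m v] `&`
    ([set v | 0 < X * ylast R k m v - normk (yk R k m v)] `&`
     \bigcup_a [set v | qnorm (mkv a (pr R k m v)) < 1]).
  apply/seteqP; split=> v.
    move=> [v0 [vX [y [y1 yv]]]]; split=> //; split; first by rewrite /= subr_gt0.
    exists (yk R k m y) => //=; rewrite -yv.
    suff -> : mkv (yk R k m y) (pr R k m y) = y by [].
    by apply: yk_pr_inj; rewrite ?yk_mkv ?pr_mkv.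
  move=> [v0 [/= vX [a _ /= av]]]; split=> //; split; first by rewrite -subr_gt0.
  by exists (mkv a (pr R k m v)); rewrite pr_mkv.
apply: openI.
  by apply: (@open_comp _ _ (ylast R k m) [set y | 0 < y]) => [v _|];
    [exact: ylast_continuous|exact: open_gt].
apply: openI.
  apply: (@open_comp _ _ (fun v => X * ylast R k m v - normk (yk R k m v)) [set y | 0 < y]).
    by move=> v _; apply: continuous_scale_sub; [exact: ylast_continuous|exact: normk_yk_continuous].
  exact: open_gt.
apply: bigcup_open => a _.
apply: (@open_comp _ _ (fun v => mkv a (pr R k m v)) [set y | qnorm y < 1]).
  by move=> v _; exact: mkv_pr_continuous.
exact: open_is_norm_lt is_norm_qnorm _.
Qed.

(** The projection of the closed ball is closed because the ball is compact. *)
Lemma closed_Kcone X : closed (Kcone X).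
Proof.
have -> : Kcone X = [set v | 0 <= X * `|ylast R k m v| - normk (yk R k m v)] `&`
    (pr R k m) @^-1` (pr R k m @` [set y | qnorm y <= 1]).
  apply/seteqP; split=> v.
    by move=> [vX [y [y1 yv]]]; split; [rewrite /= subr_ge0|exists y].
  by move=> [/= vX [y y1 yv]]; split; [rewrite -subr_ge0|exists y].
apply: closedI.
  apply: (@closed_comp _ _ (fun v => X * `|ylast R k m v| - normk (yk R k m v)) [set y | 0 <= y]).
    move=> v _; apply: continuous_scale_sub; last exact: normk_yk_continuous.
    move=> w; apply: (@continuous_comp _ _ _ (ylast R k m) (fun y => `|y|)).
      exact: ylast_continuous.
    exact: norm_continuous.
  exact: closed_ge.
apply: closed_comp => [v _|]; first exact: pr_continuous.
apply: compact_closed; first exact: norm_hausdorff.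
apply: continuous_compact; last exact: compact_is_norm_le is_norm_qnorm _.
by apply: continuous_subspaceT; exact: pr_continuous.
Qed.

Lemma Kcone_bounded X : 0 <= X -> exists c : R, forall v, Kcone X v -> `|v| <= c.
Proof.
move=> X0; have [c c0 qc] := mx_norm_le_is_norm is_norm_qnorm.
have [d d0 kd] := mx_norm_le_is_norm hnormk.
exists (d * (X * c) + c) => v [vX [y [y1 yv]]].
have yc : `|y| <= c by apply: le_trans (qc y) _; rewrite ler_piMr// ltW.
have prc : `|pr R k m v| <= c by rewrite -yv (le_trans (pr_norm_le _)).
have lc : `|ylast R k m v| <= c.
  by apply: le_trans prc; rewrite ylastE mx_entry_le_norm.
apply: le_trans (norm_le_yk_pr _) _; rewrite lerD//.
apply: le_trans (kd _) _; rewrite ler_pM2l// (le_trans vX)// ler_wpM2l//.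
Qed.

(** Only the condition [0 < y_n] fails to be closed, so the cone is the countable union of its
    closed bounded parts [1 / (i + 1) <= y_n]. *)
Lemma measurable_Hit_Acone h X : \det h = 1 -> 0 <= X ->
  measurable (Hit h (Acone X) : set (Xspace R n)).
Proof.
move=> h1 X0; have [c Kc] := Kcone_bounded X0.
have -> : Acone X = \bigcup_i (Kcone X `&` [set v | i.+1%:R^-1 <= ylast R k m v]).
  rewrite AconeE; apply/seteqP; split=> v.
    move=> [Kv /= v0]; near \oo => i; exists i => //; split=> //=; apply: ltW.
    by near: i; exact: (near_infty_natSinv_lt (PosNum v0)).
  by move=> [i _ [Kv /= iv]]; split=> //=; rewrite (lt_le_trans _ iv)// invr_gt0.
rewrite Hit_bigcup; apply: bigcupT_measurable => i.
apply: (measurable_Hit_closed (c := c) h1); last by move=> v [/Kc].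
apply: closedI; first exact: closed_Kcone.
by apply: (@closed_comp _ _ (ylast R k m) [set y | i.+1%:R^-1 <= y]) => [v _|];
  [exact: ylast_continuous|exact: closed_ge].
Unshelve. all: by end_near. Qed.

Variable mu : probability (Xspace R n) R.
Hypothesis hmu : right_invariant R n mu.

Lemma mu_Hit_Kcone X : 0 <= X -> mu (Hit g0 (Kcone X)) = mu (Hit g0 (Acone X)).
Proof.
move=> X0; have [c Kc] := Kcone_bounded X0.
pose Z := Kcone X `&` [set v | ylast R k m v = 0].
have cZ : closed Z.
  apply: closedI; first exact: closed_Kcone.
  by apply: (@closed_comp _ _ (ylast R k m) [set 0]) => [v _|];
    [exact: ylast_continuous|exact: closed_eq].
have Zc v : Z v -> `|v| <= c by case=> /Kc.
have HE : Hit g0 (Kcone X) = Hit g0 (Acone X) `|` Hit g0 Z.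
  rewrite -HitU; apply/seteqP; split; last first.
    by apply: HitS => v [|[]]//; exact: Acone_sub_Kcone.
  move=> x [x1 [z z0 Kz]]; split=> //; set v := intmx R 1 n z *m x *m g0 in Kz.
  have [v0|v0|v0] := ltrgtP (ylast R k m v) 0; last 2 first.
  - by exists z => //; left; rewrite AconeE.
  - by exists z => //; right.
  have vE : intmx R 1 n (- z) *m x *m g0 = -1 *: v.
    by rewrite /intmx map_mxN !mulNmx scaleN1r.
  exists (- z); first by rewrite oppr_eq0.
  have [vX [y [y1 yv]]] := Kz.
  rewrite vE AconeE; left; split; last by rewrite /= ylastE prZ mxE -ylastE mulN1r oppr_gt0.
  split.
    by rewrite ykZ (is_normZ hnormk) ylastE prZ mxE -ylastE normrM normrN1 !mul1r.
  exists (-1 *: y); rewrite !prZ yv (is_normZ is_norm_qnorm) normrN1 mul1r.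
  by split.
rewrite HE measureU0//.
- exact: measurable_Hit_Acone.
- exact: measurable_Hit_closed hg0 cZ Zc.
- by apply: (Hit_hyperplane0 hmu hg0 cZ Zc) => v [].
Qed.

(** [Phi(t)] with [t > 0] multiplies [pr] by [e^(-kt) < 1], which moves the closed projected ball
    into the open one, and widens the aperture of the cone by [e^(nt)]. The measure is unchanged by
    invariance, so the whole cost is the passage from [X'] to [X]. *)
Lemma mu_Hit_Ocone_ge X X' : 0 < X' -> X' < X ->
  (mu (Hit g0 (Acone X')) <= mu (Hit g0 (Ocone X)))%E.
Proof.
move=> X'0 X'X; have [N NE] : {N : R | N = n%:R} by exists n%:R.
have N0 : 0 < N by rewrite NE ltr0n.
(* The factor 2 makes the aperture [X' e^(Nt)] the geometric mean of [X'] and [X], hence strictly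
   below [X]. *)
pose t := ln (X / X') / (2 * N).
have XX' : 1 < X / X' by rewrite ltr_pdivlMr// mul1r.
have t0 : 0 < t by rewrite divr_gt0 ?ln_gt0// mulr_gt0.
have ent : expR (N * t) < X / X'.
  have lX : 0 < ln (X / X') by rewrite ln_gt0.
  rewrite -[X in _ < X]lnK; last by rewrite posrE (lt_trans _ XX').
  rewrite ltr_expR (_ : N * t = ln (X / X') / 2); first lra.
  by rewrite /t; field; rewrite gt_eqF.
have mA := measurable_Hit_Acone hg0 (ltW X'0).
rewrite -(@Hit_invariant _ _ _ g0 (g0 *m Phimx R k m (- t)) (Acone X'))//; last first.
  by rewrite det_mulmx hg0 det_Phimx mulr1.
apply: le_measure; rewrite ?inE.
- by apply: measurable_Hit_Acone (ltW X'0); rewrite det_mulmx hg0 det_Phimx mulr1.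
- by apply: measurable_Hit_open; exact: open_Ocone.
move=> x [x1 [z z0]]; rewrite !mulmxA; set v := intmx R 1 n z *m x *m g0.
rewrite AconeE => -[[vX [y [y1 yv]]] /= v0]; split=> //; exists z => //; rewrite -/v.
have vl0 : 0 < ylast R k m v by move: v0; rewrite ylast_mul_Phimx pmulr_rgt0// expR_gt0.
split=> //; split.
  move: vX; rewrite gtr0_norm// ylast_mul_Phimx yk_mul_Phimx (is_normZ hnormk).
  rewrite gtr0_norm ?expR_gt0// mulrCA -ler_pdivlMl ?expR_gt0// -expRN => vX.
  apply: (le_lt_trans vX); rewrite !mulrA -expRD.
  rewrite (_ : _ + _ = N * t); last by rewrite NE -!natr1 !natrD; ring.
  by rewrite ltr_pM2r// -ltr_pdivlMr.
exists (expR (- (k%:R * t)) *: y); split.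
  rewrite (is_normZ is_norm_qnorm) gtr0_norm ?expR_gt0//.
  rewrite (@le_lt_trans _ _ (expR (- (k%:R * t))))//; first by rewrite ler_piMr// expR_ge0.
  by rewrite expR_lt1 oppr_lt0 mulr_gt0// ltr0n.
by rewrite prZ yv pr_mul_Phimx scalerA -expRD mulrN opprK addNr expR0 scale1r.
Qed.

End Cones.

Lemma primitive_factor (n : nat) (z : 'rV[int]_n) : z != 0 ->
  exists d z0, [/\ (0 < d)%N, primitive n z0 & z = d%:Z *: z0].
Proof.
move=> z0; pose d := \big[gcdn/0%N]_(i < n) `|z ord0 i|%N.
have dz i : (d %| `|z ord0 i|)%N by exact: (biggcdn_inf i).
have d0 : (0 < d)%N.
  rewrite lt0n; apply: contra z0 => /eqP d0; apply/eqP/rowP => i; rewrite mxE.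
  have := dz i; rewrite d0 dvd0n absz_eq0 => /eqP zi0; exact: zi0.
pose w : 'rV[int]_n := \row_i (z ord0 i %/ d%:Z)%Z.
have zE i : z ord0 i = (d%:Z * w ord0 i)%R.
  by rewrite mxE mulrC divzK// /dvdz /=; exact: dz.
exists d, w; split=> //; last by apply/rowP => i; rewrite [RHS]mxE; exact: zE.
rewrite /primitive; set e := \big[gcdn/0%N]_(i < n) _.
have ew i : (e %| `|w ord0 i|)%N by exact: (biggcdn_inf i).
have : (d * e %| d)%N.
  by apply/dvdn_biggcdP => i _; rewrite zE abszM absz_nat dvdn_pmul2l.
by rewrite -[X in (_ %| X)%N]muln1 dvdn_pmul2l// dvdn1.
Qed.

(** * Hitting measures of the cones in terms of the density *)

Section TailMeasure.
Variables (R : realType) (k m : nat).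
Local Notation n := ((k + m).+1).
Variables (normk : 'rV[R]_k -> R) (normn : 'rV[R]_n -> R).
Hypotheses (hk : (0 < k)%N) (hnormk : is_norm R k normk)
  (hnormn : is_norm R n normn).
Variable g0 : 'M[R]_n.
Hypothesis hg0 : \det g0 = 1.
Local Notation Acone := (Acone normk normn g0).

(** This is what makes primitive and nonzero vectors interchangeable: if a multiple [d w] of a
    primitive [w] falls into the cone, so does [w]. *)
Lemma Acone_star X c v : 0 < c -> c <= 1 -> Acone X v -> Acone X (c *: v).
Proof.
move=> c0 c1; rewrite !AconeE// => -[[vX [y [y1 yv]]] /= v0].
split; last by rewrite /= ylastE prZ mxE -ylastE mulr_gt0.
split.
  rewrite ykZ (is_normZ hnormk) [in leRHS]ylastE prZ mxE -ylastE normrM mulrCA.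
  by rewrite ler_wpM2l.
exists (c *: y); rewrite !prZ yv; split=> //.
rewrite (is_normZ (is_norm_qnorm hnormn hg0)) gtr0_norm//.
have := is_norm_ge0 (is_norm_qnorm hnormn hg0) y; nra.
Qed.

Lemma primitive_avoidE X :
  [set g : 'M[R]_n | SLset R n g /\ forall z : 'rV[int]_n, primitive n z ->
     ~ Acone X (intmx R 1 n z *m g)] = SLset R n `\` Hit 1%:M (Acone X).
Proof.
apply/seteqP; split=> g [g1 gz]; split=> //.
  move=> [_ [z z0]]; rewrite mulmx1 => Az.
  have [d [w [d0 wp zE]]] := primitive_factor z0.
  apply: (gz w wp); have dR : 0 < d%:R :> R by rewrite ltr0n.
  have -> : intmx R 1 n w *m g = d%:R^-1 *: (intmx R 1 n z *m g).
    have dd : d%:R^-1 * (d%:Z)%:~R = 1 :> R by rewrite mulVf// gt_eqF.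
    by rewrite zE /intmx map_mxZ -scalemxAl scalerA dd scale1r.
  by apply: Acone_star => //; [rewrite invr_gt0|rewrite invf_le1// ler1n].
move=> z zp Az; apply: gz; split=> //; exists z; last by rewrite mulmx1.
apply: contraTneq zp => ->; rewrite /primitive big1 => [|i _]//.
by rewrite mxE.
Qed.

Variables (mu : probability (Xspace R n) R) (psi0 : R -> R).
Hypotheses (hmuX : is_probX R n mu) (hmu : right_invariant R n mu).
Hypothesis hpsi0_ge0 : forall r : R, 0 < r -> 0 <= psi0 r.
Hypothesis hpsi0_int : lebesgue_measure.-integrable `]0%R, +oo[%classic (EFin \o psi0).
Hypothesis hpsi0_tot :
  (\int[lebesgue_measure]_(r in `]0%R, +oo[%classic) (psi0 r)%:E = 1)%E.
Hypothesis hpsi0_tail : forall X : R, 0 < X ->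
     (\int[lebesgue_measure]_(r in `[X%R, +oo[%classic) (psi0 r)%:E)%E =
     mu [set g | SLset R n g /\ forall z : 'rV[int]_n, primitive n z ->
             ~ cone R k m [set a | normk a <= X] (Wset R k m normn g0)
                 (intmx R 1 n z *m g)].

(** The tail formula describes the complementary event at base point 1. Both [mu] on SL and the
    density have total mass 1, so complements turn the tail into an integral over []0, X[], and
    invariance moves the base point to [g0]. *)
Lemma mu_Hit_Acone X : 0 < X ->
  mu (Hit g0 (Acone X)) = (\int[lebesgue_measure]_(r in `]0%R, X[%classic) (psi0 r)%:E)%E.
Proof.
move=> X0; have mpsi := measurable_int _ hpsi0_int; have det1' : \det (1%:M : 'M[R]_n) = 1 by exact: det1.
have mA := measurable_Hit_Acone hnormk hnormn hg0 det1' (ltW X0).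
rewrite -(Hit_invariant (h := g0) (h' := 1%:M) hmu)//; last first.
  exact: measurable_Hit_Acone (ltW X0).
have tail := hpsi0_tail X0; rewrite primitive_avoidE measureD//= in tail; last 2 first.
  by apply: X_open_measurable; exact: SL_X_open.
  by rewrite -ge0_fin_numE// fin_num_measure//; apply: X_open_measurable; exact: SL_X_open.
rewrite hmuX (setIidr (@Hit_subSL _ _ _ _)) in tail.
have split01 : `]0%R, +oo[%classic = `]0%R, X[%classic `|` `[X, +oo[%classic :> set R.
  by rewrite -itv_bndbnd_setU// bnd_simp.
have := hpsi0_tot; rewrite split01 ge0_integral_setU//=; last 3 first.
- by rewrite -split01.
- move=> r rX; rewrite lee_fin; apply: hpsi0_ge0.
  by case: rX; rewrite in_itv/= ?andbT; [case/andP|exact: lt_le_trans].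
- apply/disj_setPS => r [] /=; rewrite !in_itv/= andbT => /andP[_ rX] Xr; lra.
rewrite tail -(@fineK _ (mu (Hit _ _))) ?fin_num_measure//.
case: (\int[lebesgue_measure]_(r in `]0%R, X[%classic) (psi0 r)%:E)%E => [a| |]//=.
by rewrite -EFinB -EFinD => -[aE]; congr EFin; lra.
Qed.

(** The upper bound is inclusion in [Acone X]. For the lower bound, the cones [Acone (u i)] with
    [u i] increasing to [X] have measure at most that of the open cone, and their measures converge
    by monotone convergence for the density. *)
Lemma mu_Hit_Ocone X : 0 < X ->
  mu (Hit g0 (Ocone normk normn g0 X)) =
  (\int[lebesgue_measure]_(r in `]0%R, X[%classic) (psi0 r)%:E)%E.
Proof.
move=> X0; have mpsi := measurable_int _ hpsi0_int; apply/eqP; rewrite eq_le -{1}(mu_Hit_Acone X0); apply/andP; split.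
  apply: le_measure; rewrite ?inE.
  - by apply: measurable_Hit_open; exact: open_Ocone.
  - exact: measurable_Hit_Acone (ltW X0).
  - by apply: HitS; exact: Ocone_sub.
(* With [i.+2] even the first term is positive; [i.+1] would give [u 0 = 0]. *)
pose u (i : nat) : R := X - X * i.+2%:R^-1.
have u0 i : 0 < u i.
  by rewrite /u subr_gt0 -ltr_pdivlMl// mulVf ?gt_eqF// invf_lt1// ltr1n.
have uX i : u i < X by rewrite /u ltrBlDr ltrDl mulr_gt0// invr_gt0.
have UE : \bigcup_i `]0%R, u i[%classic = `]0%R, X[%classic :> set R.
  apply/seteqP; split=> r /=.
    by move=> [i _]; rewrite /= !in_itv/= => /andP[-> ru]; exact: lt_trans ru (uX i).
  rewrite in_itv/= => /andP[r0 rX].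
  have rX0 : 0 < (X - r) / X by rewrite divr_gt0// subr_gt0.
  near \oo => i; exists i => //=; rewrite in_itv/= r0 /u ltrBrDr -ltrBrDl.
  rewrite -ltr_pdivlMl// mulrC; apply: (@lt_trans _ _ i.+1%:R^-1).
    by rewrite ltf_pV2 ?posrE// ltr_nat.
  by near: i; exact: (near_infty_natSinv_lt (PosNum rX0)).
have cvgI := @ge0_nondecreasing_set_cvg_integral _ (measurableTypeR R) R
  (fun i => `]0%R, u i[%classic) (EFin \o psi0) lebesgue_measure.
rewrite -UE; apply: (cvge_to_le (cvgI _ _ _ _)).
- move=> i j ij; apply/subsetPset => r /=; rewrite !in_itv/= => /andP[-> ru] /=.
  apply: (lt_le_trans ru); rewrite /u lerD2l lerN2 ler_pM2l//.
  by rewrite lef_pV2 ?posrE// ler_nat.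
- by move=> i; exact: measurable_itv.
- move=> i; apply: measurable_funS mpsi => // r /=; rewrite !in_itv/= andbT.
  by case/andP.
- by move=> i r /=; rewrite in_itv/= => /andP[r0 _]; rewrite lee_fin; exact: hpsi0_ge0.
apply: nearW => i /=; rewrite -(mu_Hit_Acone (u0 i)).
exact: mu_Hit_Ocone_ge.
Unshelve. all: by end_near. Qed.

End TailMeasure.

(** * The supremum of log alpha along horospheres *)

Section Event.
Variables (R : realType) (k m : nat).
Local Notation n := ((k + m).+1).
Variables (normk : 'rV[R]_k -> R) (normn : 'rV[R]_n -> R).
Hypotheses (hk : (0 < k)%N) (hnormk : is_norm R k normk)
  (hnormn : is_norm R n normn).
Variable g0 : 'M[R]_n.
Hypothesis hg0 : \det g0 = 1.
Local Notation q := (qnorm normn g0).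

Let hq : is_norm R n q. Proof. exact: is_norm_qnorm. Qed.

Definition shortened (T r : R) : set 'rV[R]_n :=
  [set w | exists s, normk s <= T /\ q (w *m Umx R k m s) < r].

Lemma open_shortened T r : open (shortened T r).
Proof.
have -> : shortened T r = \bigcup_(s in [set s | normk s <= T])
    [set w | q (w *m Umx R k m s) < r].
  apply/seteqP; split=> w; first by move=> [s [sT ws]]; exists s.
  by move=> [s sT ws]; exists s.
apply: bigcup_open => s _.
have -> : [set w | q (w *m Umx R k m s) < r] =
    (fun w => 1%:M *m w *m Umx R k m s) @^-1` [set v | q v < r].
  by apply/funext => w /=; rewrite mul1mx.
apply: open_comp => [w _|]; last exact: open_is_norm_lt.
exact: mulmx2_continuous.
Qed.

(* Pitfall: [sup] is 0 on unbounded sets, hence the need for a bound uniform in [s]. *)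
Lemma lattice_lower_bound (x : 'M[R]_n) (T : R) : \det x = 1 -> 0 <= T ->
  exists2 e : R, 0 < e & forall s (z : 'rV[int]_n), normk s <= T -> z != 0 ->
    e <= q (intmx R 1 n z *m x *m g0 *m Umx R k m s).
Proof.
move=> x1 T0; have [c c0 qc] := mx_norm_le_is_norm hq.
have [d d0 kd] := mx_norm_le_is_norm hnormk.
pose M := x *m g0.
have Mu : M \in unitmx by rewrite unitmxE det_mulmx x1 hg0 mulr1 unitr1.
(* The factors undo [q] (constant [c]), the shear by [s] with [|s| <= d T] (constant [2 + d T]) and
   the matrix [M]. As a nonzero integer vector has norm at least 1, this bounds [q] from below. *)
pose a := n%:R * ((2 + d * T) * c) * `|invmx M|.
have dT2 : 0 <= 2 + d * T by rewrite addr_ge0// mulr_ge0// ltW.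
have a0 : 0 <= a by rewrite mulr_ge0// mulr_ge0// mulr_ge0// ltW.
exists (a + 1)^-1; first by rewrite invr_gt0; lra.
move=> s z sT z0; set w := intmx R 1 n z *m x *m g0; set v := w *m Umx R k m s.
have wE : intmx R 1 n z = w *m invmx M by rewrite /w -(mulmxA _ x g0) mulmxK.
have z1 := intmx_ge1 R z0.
have s_le : `|s| <= d * T by apply: le_trans (kd s) _; rewrite ler_pM2l.
have w_le : `|w| <= (2 + d * T) * `|v|.
  have ykw : yk R k m w = yk R k m v + ylast R k m v *: s.
    have vl : ylast R k m v = ylast R k m w by rewrite !ylastE pr_mul_Umx.
    by rewrite vl yk_mul_Umx subrK.
  apply: le_trans (norm_le_yk_pr _) _; rewrite ykw -(pr_mul_Umx w s) -/v.
  have h1 := ler_normD (yk R k m v) (ylast R k m v *: s).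
  rewrite normrZ in h1; have h2 := yk_norm_le v; have h3 := pr_norm_le v.
  have h4 : `|ylast R k m v| * `|s| <= `|v| * (d * T).
    by rewrite ler_pM// mx_entry_le_norm.
  lra.
have z_le : `|intmx R 1 n z| <= a * q v.
  rewrite wE (le_trans (mulmx_norm_le _ _))// /a.
  rewrite [leRHS](_ : _ = n%:R * ((2 + d * T) * (c * q v)) * `|invmx M|); last by ring.
  rewrite ler_wpM2r// ler_wpM2l//; apply: le_trans w_le _.
  by rewrite ler_wpM2l.
rewrite -div1r ler_pdivrMr; last lra.
by have := is_norm_ge0 hq v; nra.
Qed.

(** A supremum exceeds [L] strictly exactly when one of its elements does, provided it is a genuine
    supremum; [lattice_lower_bound] ensures this for both nested suprema. The logarithm and the
    inverse then turn [L] into the length [expR (- L)]. Thus the event is the hitting set of an open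
    set, which also makes it measurable. *)
Lemma event_Hit (T L : R) : 0 <= T ->
  [set x : 'M[R]_n | SLset R n x /\
    sup [set ln (alpha R n normn (hs R k m g0 s x)) | s in [set s | normk s <= T]] > L]
  = Hit g0 (shortened T (expR (- L))).
Proof.
move=> T0; have normE x s (z : 'rV[int]_n) : normn (intmx R 1 n z *m hs R k m g0 s x) =
    q (intmx R 1 n z *m x *m g0 *m Umx R k m s).
  by rewrite /qnorm /hs !mulmxA.
have bounds x : \det x = 1 -> exists2 e : R, 0 < e & forall s, normk s <= T ->
    has_sup [set (normn (intmx R 1 n z *m hs R k m g0 s x))^-1 |
      z in [set z : 'rV[int]_n | z != 0]] /\
    0 < alpha R n normn (hs R k m g0 s x) <= e.
  move=> x1; have [e e0 eP] := lattice_lower_bound x1 T0.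
  exists e^-1; first by rewrite invr_gt0.
  move=> s sT; set S := [set _ | _ in _].
  pose z1 : 'rV[int]_n := const_mx 1.
  have z10 : z1 != 0 by apply/rV0Pn; exists ord0; rewrite mxE.
  have Sz1 : S (normn (intmx R 1 n z1 *m hs R k m g0 s x))^-1 by exists z1.
  have Sub : ubound S e^-1.
    move=> _ [z /= z0 <-]; rewrite normE; have qe := eP s z sT z0.
    by rewrite lef_pV2 ?posrE// (lt_le_trans e0).
  have Ssup : has_sup S by split; [exists (normn (intmx R 1 n z1 *m hs R k m g0 s x))^-1|exists e^-1].
  split=> //; apply/andP; split.
    apply: (lt_le_trans _ (ub_le_sup (proj2 Ssup) Sz1)).
    by rewrite invr_gt0 normE (lt_le_trans e0)// eP.
  by apply: ge_sup => //; exists (normn (intmx R 1 n z1 *m hs R k m g0 s x))^-1.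
have norm0 : normk 0 <= T by rewrite is_norm0.
apply/seteqP; split=> x [x1].
  move=> /sup_gt[|_ [s /= sT <-]]; first by exists (ln (alpha R n normn (hs R k m g0 0 x))); exists 0.
  have [e e0 /(_ s sT)[Ssup /andP[al0 _]]] := bounds x x1.
  rewrite -ltr_expR lnK// => /sup_gt[|_ [z /= z0 <-]]; first by case: Ssup.
  have [e' e'0 /(_ s z sT z0) e'q] := lattice_lower_bound x1 T0.
  rewrite normE => Lq; split=> //; exists z => //; exists s; split=> //.
  rewrite expRN; rewrite -[ltLHS]invrK ltf_pV2 ?posrE ?expR_gt0// invr_gt0.
  exact: lt_le_trans e'q.
move=> [z z0 [s [sT zs]]]; split=> //.
have [e e0 eP] := bounds x x1; have [Ssup /andP[al0 _]] := eP s sT.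
apply: (@lt_le_trans _ _ (ln (alpha R n normn (hs R k m g0 s x)))); last first.
  apply: ub_le_sup; last by exists s.
  exists (ln e) => _ [u /= uT <-]; have [_ /andP[au0 aue]] := eP u uT.
  by rewrite ler_ln.
rewrite -ltr_expR lnK//.
apply: (lt_le_trans _ (ub_le_sup (proj2 Ssup) _)); last by exists z.
have [e' e'0 /(_ s z sT z0) e'q] := lattice_lower_bound x1 T0.
rewrite normE -[ltLHS]invrK ltf_pV2 ?posrE ?invr_gt0 ?expR_gt0//; last exact: lt_le_trans e'q.
by rewrite -expRN.
Qed.

Lemma expR_natM_ge (t : R) : 0 <= t -> t <= expR (n%:R * t).
Proof.
move=> t0; apply: le_trans (expR_ge1Dx _).
by rewrite -natr1 mulrDl mul1r addrA ler_wpDl// addr_ge0// mulr_ge0.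
Qed.

(** Choosing [y] in the open ball with [pr y = pr v], one solves [v Phi(t) U(s) = e^(-kt) y] for
    [s]. Erosion improves the aperture bound to [|v'| < X (v_n - e)], and the saving [e^(nt) X e]
    absorbs the bounded vector [y'] once [t >= d c / (X e)]. *)
Lemma erode_sub_shortened (e X : R) : 0 < e -> 0 < X ->
  \forall t \near +oo, forall v, erode (Ocone normk normn g0 X) e v ->
    shortened (expR (n%:R * t) * X) (expR (- (k%:R * t))) (v *m Phimx R k m t).
Proof.
move=> e0 X0; have [c c0 qc] := mx_norm_le_is_norm hq.
have [d d0 kd] := is_norm_le_mx_norm hnormk.
near=> t; have t0 : 0 <= t by near: t; apply: nbhs_pinfty_ge; exact: num_real.
have bt : d * c / (X * e) <= t by near: t; apply: nbhs_pinfty_ge; exact: num_real.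
move=> v [e' ee' e'O].
have vO : Ocone normk normn g0 X v by apply: e'O; rewrite subrr normr0; exact: lt_trans e0 ee'.
have [vl0 [vX [y [y1 yv]]]] := vO.
(* Lowering the last coordinate by [e] stays within the margin of the erosion and leaves [v']
   untouched; this produces the slack in the aperture bound. *)
pose u := mkv (yk R k m v) (pr R k m v - e *: delta_mx 0 ord_max).
have uO : Ocone normk normn g0 X u.
  apply: e'O; apply: le_lt_trans (norm_le_yk_pr _) _.
  rewrite ykB prB yk_mkv pr_mkv subrr normr0 add0r opprB addrC subrK.
  rewrite normrZ gtr0_norm//; apply: le_lt_trans ee'.
  rewrite (ler_piMr (ltW e0))//; apply: mx_norm_le_entry => // i j; rewrite mxE.
  by case: (_ && _); rewrite ?normr1 ?normr0.
have [ul0 [uX _]] := uO.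
have ulE : ylast R k m u = ylast R k m v - e.
  by rewrite !ylastE pr_mkv !mxE !eqxx mulr1.
rewrite ulE in ul0 uX; rewrite yk_mkv in uX.
set E := expR (n%:R * t).
have E0 : 0 < E by exact: expR_gt0.
pose s := (ylast R k m v)^-1 *: (E *: yk R k m v - yk R k m y).
exists s; split.
  rewrite (is_normZ hnormk) normfV gtr0_norm// mulrC ler_pdivrMr//.
  apply: le_trans (is_norm_sub hnormk _ _) _; rewrite (is_normZ hnormk) gtr0_norm//.
  have yc : normk (yk R k m y) <= d * c.
    apply: le_trans (kd _) _; rewrite ler_pM2l//; apply: le_trans (yk_norm_le _) _.
    by apply: le_trans (qc y) _; rewrite ler_piMr// ltW.
  have EX : d * c <= E * (X * e).
    rewrite -ler_pdivrMr ?mulr_gt0// (le_trans bt)//; exact: expR_natM_ge.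
  rewrite (le_trans (lerD (ler_wpM2l (ltW E0) (ltW uX)) yc))//.
  rewrite [leLHS](_ : _ = E * X * ylast R k m v + (d * c - E * (X * e))); last by ring.
  by rewrite gerDl; lra.
suff -> : v *m Phimx R k m t *m Umx R k m s = expR (- (k%:R * t)) *: y.
  by rewrite (is_normZ hq) gtr0_norm ?expR_gt0// gtr_pMr// expR_gt0.
apply: yk_pr_inj; last by rewrite pr_mul_Umx pr_mul_Phimx prZ yv.
rewrite yk_mul_Umx yk_mul_Phimx ylast_mul_Phimx ykZ /s scalerA mulfK ?gt_eqF//.
rewrite scalerBr scalerA /E -expRD (_ : - (k%:R * t) + n%:R * t = m.+1%:R * t).
  by rewrite opprB addrCA subrr addr0.
by rewrite -!natr1 natrD; ring.
Unshelve. all: by end_near. Qed.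

(** Dropping the term [e^(-nt) y'] from [v'] gives a point [u] of the double cone with the same
    [pr], at distance at most [e^(-nt) c] from [v]. The sign of [v_n] is not controlled here, which
    is why the double cone appears. *)
Lemma shortened_sub_thicken (e X : R) : 0 < e -> 0 < X ->
  \forall t \near +oo, forall w,
    shortened (expR (n%:R * t) * X) (expR (- (k%:R * t))) w ->
    thicken (Kcone normk normn g0 X) e (w *m Phimx R k m (- t)).
Proof.
move=> e0 X0; have [c c0 qc] := mx_norm_le_is_norm hq.
near=> t; have t0 : 0 <= t by near: t; exact: nbhs_pinfty_ge.
have ct : c / e < t by near: t; apply: nbhs_pinfty_gt; exact: num_real.
move=> w [s [sT ws]]; set v := w *m Phimx R k m (- t).
have E0 : 0 < expR (n%:R * t) by exact: expR_gt0.
have F0 : 0 < expR (k%:R * t) by exact: expR_gt0.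
have wE : w = v *m Phimx R k m t by rewrite /v -mulmxA PhimxD addNr Phimx0 mulmx1.
pose y := expR (k%:R * t) *: (w *m Umx R k m s).
have y1 : q y < 1.
  by rewrite (is_normZ hq) gtr0_norm// -ltr_pdivlMl// mulr1 -expRN.
have yv : pr R k m y = pr R k m v.
  by rewrite prZ pr_mul_Umx wE pr_mul_Phimx scalerA -expRD addrN expR0 scale1r.
have yk_y : yk R k m y = expR (n%:R * t) *: yk R k m v - ylast R k m v *: s.
  rewrite ykZ yk_mul_Umx wE yk_mul_Phimx ylast_mul_Phimx scalerBr !scalerA mulrA.
  rewrite -!expRD addrN expR0 mul1r (_ : k%:R * t + m.+1%:R * t = n%:R * t)//.
  by rewrite -!natr1 natrD; ring.
pose u := mkv (expR (- (n%:R * t)) *: (ylast R k m v *: s)) (pr R k m v).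
have ulE : ylast R k m u = ylast R k m v by rewrite !ylastE pr_mkv.
exists u.
  split; last by exists y; split; [exact: ltW|rewrite pr_mkv].
  rewrite yk_mkv ulE scalerA (is_normZ hnormk) normrM gtr0_norm ?expR_gt0//.
  rewrite -mulrA mulrCA mulrC ler_wpM2r//.
  by rewrite expRN ler_pdivrMl.
apply: le_lt_trans (norm_le_yk_pr _) _; rewrite ykB prB yk_mkv pr_mkv subrr normr0 addr0.
rewrite (_ : _ - _ = expR (- (n%:R * t)) *: yk R k m y); last first.
  by rewrite yk_y scalerBr [in RHS]scalerA -expRD addNr expR0 scale1r.
rewrite normrZ gtr0_norm ?expR_gt0// expRN mulrC ltr_pdivrMr//.
have yc : `|yk R k m y| <= c.
  by apply: le_trans (yk_norm_le _) _; apply: le_trans (qc y) _; rewrite ler_piMr// ltW.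
apply: le_lt_trans yc _; rewrite -ltr_pdivrMl// mulrC.
exact: lt_le_trans ct (expR_natM_ge _).
Unshelve. all: by end_near. Qed.

End Event.

Theorem theorem8 (R : realType) (k m : nat) (hk : (0 < k)%N)
  (normk : 'rV[R]_k -> R) (hnormk : is_norm R k normk)
  (normn : 'rV[R]_((k + m).+1) -> R) (hnormn : is_norm R (k + m).+1 normn)
  (mu : probability (Xspace R (k + m).+1) R)
  (hmuX : is_probX R (k + m).+1 mu)
  (hmu : right_invariant R (k + m).+1 mu)
  (psi0 : R -> R)
  (hpsi0_ge0 : forall r : R, 0 < r -> 0 <= psi0 r)
  (hpsi0_int : lebesgue_measure.-integrable `]0%R, +oo[%classic (EFin \o psi0))
  (hpsi0_tot : (\int[lebesgue_measure]_(r in `]0%R, +oo[%classic) (psi0 r)%:E = 1)%E)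
  (g0 : 'M[R]_((k + m).+1)) (hg0 : \det g0 = 1)
  (hpsi0_tail : forall X : R, 0 < X ->
     (\int[lebesgue_measure]_(r in `[X%R, +oo[%classic) (psi0 r)%:E)%E =
     mu [set g | SLset R (k + m).+1 g /\
           forall z : 'rV[int]_((k + m).+1), primitive (k + m).+1 z ->
             ~ cone R k m [set a | normk a <= X] (Wset R k m normn g0)
                 (intmx R 1 (k + m).+1 z *m g)])
  (lam : probability (Xspace R (k + m).+1) R)
  (hlamX : is_probX R (k + m).+1 lam)
  (hlam_adm : forall E : set (Xspace R (k + m).+1),
     measurable E -> E `<=` SLset R (k + m).+1 ->
     mu (bdryX R (k + m).+1 E) = 0%E ->
     lam (rtrans R (k + m).+1 E (phimx R k m g0 t)) @[t --> +oo] --> mu E)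
  (Y : R) :
  let n : R := (k + m).+1%:R in
  let eta (y : R) : R :=
    n / k%:R * expR (- (n * y / k%:R)) * psi0 (expR (- (n * y / k%:R))) in
  lam [set x | SLset R (k + m).+1 x /\
         sup [set ln (alpha R (k + m).+1 normn (hs R k m g0 s x))
             | s in [set s | normk s <= T]] > Y + k%:R / n * ln T]
    @[T --> +oo]
  --> (\int[lebesgue_measure]_(y in `[Y%R, +oo[%classic) (eta y)%:E)%E.
Proof.
move=> n eta.
have k0 : 0 < k%:R :> R by rewrite ltr0n.
have n0 : 0 < n by rewrite /n ltr0n.
have nk0 : 0 < n / k%:R by rewrite divr_gt0.
have mpsi := measurable_int _ hpsi0_int.
pose X := expR (- (n / k%:R * Y)).
have X0 : 0 < X by exact: expR_gt0.
pose p := fine (mu (Hit g0 (Acone normk normn g0 X))).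
have mA : measurable (Hit g0 (Acone normk normn g0 X) : set (Xspace R (k + m).+1)).
  exact: measurable_Hit_Acone (ltW X0).
have pE : mu (Hit g0 (Acone normk normn g0 X)) = p%:E by rewrite fineK ?fin_num_measure.
have muA Z := mu_Hit_Acone hnormk hnormn hg0 hmuX hmu hpsi0_ge0 hpsi0_int
  hpsi0_tot hpsi0_tail (X := Z).
(* The substitution [r = e^(-ny/k)] turns the integral of [eta] over [[Y, +oo[] into that of [psi0]
   over []0, X]]; the endpoint [X] carries no mass. *)
have -> : (\int[lebesgue_measure]_(y in `[Y%R, +oo[%classic) (eta y)%:E)%E = p%:E.
  have subX : (`]0%R, X]%classic : set R) `<=` `]0%R, +oo[%classic.
    by move=> r /=; rewrite !in_itv/= andbT => /andP[].
  rewrite -pE muA// integral_itv_bndo_bndc; last first.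
    apply: measurable_funS mpsi => // r /=; rewrite !in_itv/= andbT.
    by case/andP.
  rewrite -(@integral_exp_substitution R (PosNum nk0) Y psi0 hpsi0_ge0); last first.
    exact: measurable_funS mpsi.
  apply: eq_integral => y _; rewrite /eta /exp_density /=.
  by rewrite (mulrAC n y).
(* One [t] has to satisfy both [e^(nt) X = T] and [e^(-kt) = e^-Y T^(-k/n)]; the two equations are
   compatible exactly because [X = e^(-nY/k)]. *)
pose t (T : R) := Y / k%:R + ln T / n.
have tT T : 0 < T -> expR (n * t T) * X = T.
  move=> T0; rewrite /X -expRD -[RHS]lnK//; congr expR; rewrite /t.
  by field; rewrite !gt_eqF.
have tr T : expR (- (k%:R * t T)) = expR (- (Y + k%:R / n * ln T)).
  by congr expR; rewrite /t; field; rewrite !gt_eqF.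
have ty : t T @[T --> +oo] --> +oo.
  apply/cvgryPge => A; near=> T.
  have lT : n * (A - Y / k%:R) <= ln T.
    rewrite -ler_expR lnK; last by rewrite posrE; near: T; apply: nbhs_pinfty_gt.
    by near: T; apply: nbhs_pinfty_ge; exact: num_real.
  by rewrite /t -lerBlDl ler_pdivlMr// mulrC.
have [c Kc] := Kcone_bounded hnormk hnormn hg0 (ltW X0).
pose D T := shortened normk normn g0 T (expR (- (Y + k%:R / n * ln T))).
have lim := @sandwich_cvg R (k + m).+1 mu g0 hg0 lam (phimx R k m g0)
  (fun t => det_phimx t hg0) hlam_adm (Ocone normk normn g0 X)
  (Kcone normk normn g0 X) c p (fun T => Hit g0 (D T)) t.
apply: cvg_trans (lim _ _ _ _ _ _ _ _ _ _).
- apply: near_eq_cvg; near=> T; congr (lam _).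
  apply/esym; apply: (event_Hit hnormk hnormn hg0).
  by near: T; apply: nbhs_pinfty_ge.
- exact: open_Ocone.
- move=> v Ov; apply: Kc; apply: (Acone_sub_Kcone hnormk hg0).
  exact: Ocone_sub Ov.
- exact: closed_Kcone.
- exact: Kc.
- by rewrite -pE muA//; apply: (@mu_Hit_Ocone _ _ _ _ _ hk hnormk hnormn _ hg0 mu psi0).
- by rewrite -pE; exact: mu_Hit_Kcone (ltW X0).
- exact: ty.
- by move=> T; apply: measurable_Hit_open; exact: open_shortened.
- move=> e e0; have near_t := ty _ (erode_sub_shortened hnormk hnormn hg0 e0 X0).
  near=> T; have T0 : 0 < T by near: T; apply: nbhs_pinfty_gt.
  have sub : forall v, erode (Ocone normk normn g0 X) e v ->
      D T (v *m Phimx R k m (t T)).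
    by rewrite /D -tr -[X in shortened _ _ _ X _](tT T T0); near: T; exact: near_t.
  rewrite rtrans_Hit_phimx// => x [x1 [z z0]]; rewrite mulmxA => /sub Dz.
  split=> //; exists z => //; move: Dz.
  by rewrite -!mulmxA PhimxD addNr Phimx0 mulmx1.
- move=> e e0; have near_t := ty _ (shortened_sub_thicken hnormk hnormn hg0 e0 X0).
  near=> T; have T0 : 0 < T by near: T; apply: nbhs_pinfty_gt.
  have sub : forall w, D T w -> thicken (Kcone normk normn g0 X) e (w *m Phimx R k m (- t T)).
    by rewrite /D -tr -[X in shortened _ _ _ X _](tT T T0); near: T; exact: near_t.
  rewrite rtrans_Hit_phimx// => x [x1 [z z0 /sub Dz]].
  by split=> //; exists z => //; rewrite mulmxA.
Unshelve. all: by end_near. Qed.
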